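(* For the multinomial logistic model described in the context, the determinant of the Fisher information matrix is $$|\mathbf F|=n^p|\mathbf G^T\mathbf W\mathbf G|=n^p\sum_{\alpha_1\ge0,\dots,\alpha_m\ge0:\ \sum_{i=1}^m\alpha_i=p}c_{\alpha_1,\dots,\alpha_m}\,w_1^{\alpha_1}\cdots w_m^{\alpha_m}$$ with $$c_{\alpha_1,\dots,\alpha_m}=\sum_{(i_1,\dots,i_p)\in\Lambda(\alpha_1,\dots,\alpha_m)}|\mathbf G[i_1,\dots,i_p]|^2\prod_{k:\alpha_k>0}\ \prod_{l:(k-1)J<i_l\le kJ}\pi_{k,i_l-(k-1)J}^{-1}\ \ge 0,$$ where $\alpha_1,\dots,\alpha_m$ are nonnegative integers, $\Lambda(\alpha_1,\dots,\alpha_m)=\{(i_1,\dots,i_p)\mid 1\le i_1<\cdots<i_p\le mJ;\ \#\{l:(k-1)J<i_l\le kJ\}=\alpha_k,\ k=1,\dots,m\}$, and $\mathbf G[i_1,\dots,i_p]$ is the submatrix consisting of the $i_1$th, $\dots$, $i_p$th rows of $\mathbf G$.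
   Context: Let $d\ge 1$, $m\ge 2$, $J\ge 2$ be integers, $\mathbf x_1,\dots,\mathbf x_m\in\mathbb R^d$ distinct experimental settings, and $n_1,\dots,n_m\ge 0$ integers with $n=\sum_i n_i>0$; $w_i=n_i/n$. For each $i$ with $n_i>0$ one observes $\mathbf Y_i=(Y_{i1},\dots,Y_{iJ})^T\sim{\rm Multinomial}(n_i;\pi_{i1},\dots,\pi_{iJ})$, independently over $i$; write $\boldsymbol\pi_i=(\pi_{i1},\dots,\pi_{iJ})^T$, $\sum_j\pi_{ij}=1$. Model. Known functions $\mathbf h_j$ with values in $\mathbb R^{p_j}$ ($j=1,\dots,J-1$) and $\mathbf h_c$ with values in $\mathbb R^{p_c}$ are given; the parameter is $\boldsymbol\theta=(\boldsymbol\beta_1^T,\dots,\boldsymbol\beta_{J-1}^T,\boldsymbol\zeta^T)^T\in\mathbb R^p$ with $\boldsymbol\beta_j\in\mathbb R^{p_j}$, $\boldsymbol\zeta\in\mathbb R^{p_c}$, $p=p_1+\dots+p_{J-1}+p_c$. ($p_c=0$, i.e. no $\mathbf h_c,\boldsymbol\zeta$, is allowed.) For one fixed choice among four logit types, $\log(\nu_{ij}/\delta_{ij})=\mathbf h_j^T(\mathbf x_i)\boldsymbol\beta_j+\mathbf h_c^T(\mathbf x_i)\boldsymbol\zeta$ for $j=1,\dots,J-1$, where $(\nu_{ij},\delta_{ij})$ is: $(\pi_{ij},\pi_{iJ})$ (baseline-category); $(\pi_{i1}+\dots+\pi_{ij},\ \pi_{i,j+1}+\dots+\pi_{iJ})$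 (cumulative); $(\pi_{ij},\pi_{i,j+1})$ (adjacent-categories); $(\pi_{ij},\ \pi_{i,j+1}+\dots+\pi_{iJ})$ (continuation-ratio). It is assumed that $\pi_{ij}>0$ for all $i,j$. Matrices. $\mathbf C^T=\begin{pmatrix}\mathbf I_{J-1}&-\mathbf I_{J-1}&\mathbf 0\\ \mathbf 0^T&\mathbf 0^T&1\end{pmatrix}$ is $J\times(2J-1)$; $\mathbf L$ is the $(2J-1)\times J$ 0-1 matrix with $(\mathbf L\boldsymbol\pi_i)_j=\nu_{ij}$, $(\mathbf L\boldsymbol\pi_i)_{J-1+j}=\delta_{ij}$ ($j=1,\dots,J-1$), and last row all ones. With $\mathbf D_i={\rm diag}(\mathbf L\boldsymbol\pi_i)$, the $J\times J$ matrix $\mathbf C^T\mathbf D_i^{-1}\mathbf L$ is nonsingular; write $(\mathbf C^T\mathbf D_i^{-1}\mathbf L)^{-1}=(\mathbf c_{i1},\dots,\mathbf c_{iJ})$ by columns. $\mathbf W={\rm diag}\{w_1{\rm diag}(\boldsymbol\pi_1)^{-1},\dots,w_m{\rm diag}(\boldsymbol\pi_m)^{-1}\}$ ($mJ\times mJ$), and $\mathbf G$ is the $mJ\times p$ matrix whose $i$th block of $J$ rows is $\big(\mathbf c_{i1}\mathbf h_1^T(\mathbf x_i),\dots,\mathbf c_{i,J-1}\mathbf h_{J-1}^T(\mathbf x_i),\sum_{j=1}^{J-1}\mathbf c_{ij}\cdot\mathbf h_c^T(\mathbf x_i)\big)$. The Fisher information matrix $\mathbf F$ is the covariance matrix of the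 score vector $\partial l/\partial\boldsymbol\theta$, where $l$ is the log-likelihood of $(\mathbf Y_i)_i$. $|\cdot|$ denotes the determinant. *)

(* Defs.v *)
From HB Require Import structures.
From mathcomp Require Import all_boot all_order all_algebra.
From mathcomp Require Import all_classical all_reals all_analysis.

Set Implicit Arguments.
Unset Strict Implicit.
Unset Printing Implicit Defensive.

Import Order.TTheory GRing.Theory Num.Theory.
Import numFieldNormedType.Exports.

Local Open Scope classical_set_scope.
Local Open Scope ring_scope.

Inductive logit_type := Baseline | Cumulative | Adjacent | Continuation.

(* Response categories are the elements of 'I_J, counted from 0, and the logits
   are indexed by j : 'I_J.-1.  nu_cat and delta_cat are the categories whose
   probabilities are summed in nu_ij and in delta_ij. *)
Definition nu_cat (lt : logit_type) (J : nat) (j : 'I_J.-1) : {set 'I_J} :=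
  match lt with
  | Cumulative => [set k : 'I_J | (k <= j)%N]%SET
  | Baseline | Adjacent | Continuation => [set k : 'I_J | k == j :> nat]%SET
  end.

Definition delta_cat (lt : logit_type) (J : nat) (j : 'I_J.-1) : {set 'I_J} :=
  match lt with
  | Baseline => [set k : 'I_J | k.+1 == J]%SET
  | Adjacent => [set k : 'I_J | k == j.+1 :> nat]%SET
  | Cumulative | Continuation => [set k : 'I_J | (j < k)%N]%SET
  end.

Section RowBlocks.
Context {m J : nat}.

Lemma row_cat_subproof (r : 'I_(m * J)) : (r %% J < J)%N.
Proof. by rewrite ltn_mod; case: J r => // -[k]; rewrite muln0. Qed.

Lemma row_block_subproof (r : 'I_(m * J)) : (r %/ J < m)%N.
Proof. by rewrite ltn_divLR// (leq_ltn_trans _ (row_cat_subproof r)). Qed.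

(* Row r of a matrix with m blocks of J rows is row row_cat r of block
   row_block r. *)
Definition row_block (r : 'I_(m * J)) : 'I_m := Ordinal (row_block_subproof r).
Definition row_cat (r : 'I_(m * J)) : 'I_J := Ordinal (row_cat_subproof r).

(* With indices from 0, (k-1)J < i <= kJ reads kJ <= r < (k+1)J. *)
Definition in_block (k : 'I_m) (r : 'I_(m * J)) : bool :=
  (k * J <= r < k.+1 * J)%N.

Definition Lambda (p : nat) (alpha : 'I_m -> nat) : {set p.-tuple 'I_(m * J)} :=
  [set s : p.-tuple 'I_(m * J) |
    sorted ltn [seq val r | r <- s] &&
    [forall k, #|[set l : 'I_p | in_block k (tnth s l)]%SET| == alpha k]]%SET.

End RowBlocks.

Section Sampling.
Context {R : realType} {J : nat}.

Definition multinomial_pmf (N : nat) (q : 'cV[R]_J) (y : J.-tuple nat) : R :=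
  if (\sum_(j < J) tnth y j == N)%N then
    N`!%:R / (\prod_(j < J) (tnth y j)`!)%N%:R
      * \prod_(j < J) q j 0 ^+ tnth y j
  else 0.

Definition multinomial_law d (T : measurableType d) (P : probability T R)
    (N : nat) (q : 'cV[R]_J) (Y : {RV P >-> (J.-tuple nat)}) : Prop :=
  forall y, P (Y @^-1` [set y]) = (multinomial_pmf N q y)%:E.

Definition mutually_independent d (T : measurableType d) d'
    (T' : measurableType d') (P : probability T R) (I : finType) (D : {set I})
    (Y : I -> {RV P >-> T'}) : Prop :=
  forall (S : {set I}) (A : I -> set T'), S \subset D ->
    (forall i, i \in S -> measurable (A i)) ->
    P (\bigcap_(i in [set` S]) (Y i @^-1` A i))
      = (\prod_(i in S) P (Y i @^-1` A i))%E.

End Sampling.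

Section Matrices.
Context {R : realType} {J : nat}.

(* pid_mx J.-1 is the identity of order J - 1 on top of a zero row. *)
Definition CT_mx : 'M[R]_(J, J.-1 + J.-1 + 1) :=
  row_mx (row_mx (pid_mx J.-1) (- pid_mx J.-1))
         (\col_(a < J) (a.+1 == J)%:R).

Definition L_mx (lt : logit_type) : 'M[R]_(J.-1 + J.-1 + 1, J) :=
  col_mx (col_mx (\matrix_(j < J.-1, k < J) (k \in nu_cat lt j)%:R)
                 (\matrix_(j < J.-1, k < J) (k \in delta_cat lt j)%:R))
         (const_mx 1).

Definition D_mx (lt : logit_type) (q : 'cV[R]_J) : 'M[R]_(J.-1 + J.-1 + 1) :=
  diag_mx (L_mx lt *m q)^T.

Definition c_vec (lt : logit_type) (q : 'cV[R]_J) (j : 'I_J) : 'cV[R]_J :=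
  col j (invmx (CT_mx *m invmx (D_mx lt q) *m L_mx lt)).

End Matrices.

Section Model.
Context {R : realType} {d m J : nat} {ps : 'I_J.-1 -> nat} {pc : nat}.
Variables (lt : logit_type) (x : 'I_m -> 'cV[R]_d).
Variable h : forall j : 'I_J.-1, 'cV[R]_d -> 'cV[R]_(ps j).
Variable hc : 'cV[R]_d -> 'cV[R]_pc.

Local Notation p := (\sum_j ps j + pc)%N.

Definition beta (t : 'cV[R]_p) (j : 'I_J.-1) : 'cV[R]_(ps j) :=
  submxcol (usubmx t) j.

Definition zeta (t : 'cV[R]_p) : 'cV[R]_pc := dsubmx t.

Definition logit_model (t : 'cV[R]_p) (q : 'I_m -> 'cV[R]_J) : Prop :=
  [/\ forall i j, 0 < q i j 0,
      forall i, \sum_(j < J) q i j 0 = 1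
    & forall (i : 'I_m) (j : 'I_J.-1),
        ln ((\sum_(k in nu_cat lt j) q i k 0)
              / (\sum_(k in delta_cat lt j) q i k 0))
        = ((h j (x i))^T *m beta t j) 0 0 + ((hc (x i))^T *m zeta t) 0 0].

(* The parameters for which positive category probabilities exist; this is all
   of R^p except for cumulative logits, where the j-th linear predictor has to
   be strictly increasing in j at every setting. *)
Definition param_space : set 'cV[R]_p := [set t | exists q, logit_model t q].

Definition G_block (q : 'I_m -> 'cV[R]_J) (i : 'I_m) : 'M[R]_(J, p) :=
  let c (j : 'I_J.-1) := c_vec lt (q i) (widen_ord (leq_pred J) j) in
  row_mx (\mxrow_(j < J.-1) (c j *m (h j (x i))^T))
         ((\sum_(j < J.-1) c j) *m (hc (x i))^T).

Definition G_mx (q : 'I_m -> 'cV[R]_J) : 'M[R]_(m * J, p) :=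
  \matrix_(r, a) G_block q (row_block r) (row_cat r) a.

Definition weight (ns : 'I_m -> nat) (i : 'I_m) : R :=
  (ns i)%:R / (\sum_i ns i)%N%:R.

Definition W_mx (ns : 'I_m -> nat) (q : 'I_m -> 'cV[R]_J) : 'M[R]_(m * J) :=
  diag_mx (\row_r (weight ns (row_block r)
                     * (q (row_block r) (row_cat r) 0)^-1)).

Definition coef (q : 'I_m -> 'cV[R]_J) (alpha : 'I_m -> nat) : R :=
  \sum_(s in Lambda p alpha)
    (\det (rowsub (tnth s) (G_mx q))) ^+ 2
    * \prod_(k < m | (0 < alpha k)%N)
        \prod_(l < p | in_block k (tnth s l)) (q k (row_cat (tnth s l)) 0)^-1.

Section Fisher.
Variables (ns : 'I_m -> nat) (pi : 'cV[R]_p -> 'I_m -> 'cV[R]_J).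

Definition loglik (y : 'I_m -> J.-tuple nat) (t : 'cV[R]_p) : R :=
  ln (\prod_(i < m | (0 < ns i)%N) multinomial_pmf (ns i) (pi t i) (y i)).

Definition score (y : 'I_m -> J.-tuple nat) (t : 'cV[R]_p) (a : 'I_p) : R :=
  'D_(delta_mx a 0) (loglik y) t.

Definition Fisher_information d' (T : measurableType d') (P : probability T R)
    (Y : 'I_m -> {RV P >-> (J.-tuple nat)}) (t : 'cV[R]_p) : 'M[R]_p :=
  \matrix_(a, b) fine (covariance P (fun o => score (fun i => Y i o) t a)
                                    (fun o => score (fun i => Y i o) t b)).

End Fisher.
End Model.

(* Main.v *)
(* The logit equations nu_j = exp(eta_j) delta_j together with sum_k pi_k = 1
   are linear in pi, with a matrix that is nonsingular for all positive odds.
   Hence pi is a differentiable function of eta by Cramer's rule, and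
   differentiating the equations shows that the Jacobian of pi_i with respect to
   theta is the i-th block of G.  The score is thus, up to null outcomes, a sum
   over i of independent linear forms sum_j Y_ij G_ij / pi_ij, which are centred
   because the columns of a block of G sum to zero; as the covariance matrix of
   Y_i acts on such forms as n_i diag(pi_i), F = n G^T W G.  The expansion of the
   determinant is the Cauchy-Binet formula, grouped by the number of selected
   rows in each block. *)

Require Import Defs.
From HB Require Import structures.
From mathcomp Require Import all_boot all_order all_algebra all_fingroup ring.
From mathcomp Require Import all_classical all_reals all_analysis.

Set Implicit Arguments.
Unset Strict Implicit.
Unset Printing Implicit Defensive.

Import Order.TTheory GRing.Theory Num.Theory.
Import numFieldNormedType.Exports.

Local Open Scope classical_set_scope.
Local Open Scope ring_scope.

(** * Cauchy-Binet formula *)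

(** The obstacle is that [pi] is only assumed to satisfy the model on [param_space]; nothing is
    assumed about its smoothness or about its values elsewhere. Smoothness comes from uniqueness:
    positive solutions of the logit equations must equal the explicit [cat_prob], which stays
    positive near a parameter where it is positive, so derivatives are computed on functions that
    agree near the base point of a line. Nonsingularity has two mechanisms. In the homogeneous
    system the coordinates sum to zero; for baseline and adjacent logits they are positive multiples
    of the last one, for cumulative and continuation logits every tail sum is killed by a positive
    factor. The argument works for any positive diagonal, so it covers C^T D^-1 L as well. The
    passage from measure to algebra is [expectation_outcomes]: the score vanishes on counts with a
    wrong total, so its moments are finite sums. Settings with n_i = 0 are carried along in these
    sums with weight one on the zero count. *)

Section CauchyBinet.
Variables (R : comRingType) (N p : nat).
Implicit Types (A : 'M[R]_(p, N)) (B : 'M[R]_(N, p)).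

(** Leibniz expansion with the product of the entry sums distributed over all maps f; for fixed f
    the sum over permutations is again a determinant. *)
Lemma det_mulmx_ffun A B :
  \det (A *m B) =
    \sum_(f : {ffun 'I_p -> 'I_N}) \det (rowsub f B) * \prod_i A i (f i).
Proof.
transitivity (\sum_(f : {ffun 'I_p -> 'I_N}) \sum_(s : 'S_p)
    (-1) ^+ s * \prod_i (A i (f i) * B (f i) (s i))).
  rewrite exchange_big; apply: eq_bigr => /= s _; rewrite -big_distrr /=.
  rewrite -(bigA_distr_bigA (fun i k => A i k * B k (s i))) /=.
  by congr (_ * _); apply: eq_bigr => i _; rewrite mxE.
apply: eq_bigr => f _; rewrite mulrC big_distrr /=.
apply: eq_bigr => s _; rewrite mulrCA big_split //=; congr (_ * (_ * _)).
by apply: eq_bigr => i _; rewrite mxE.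
Qed.

Lemma sorted_ltn_inj (s : p.-tuple 'I_N) :
  sorted ltn [seq val r | r <- s] -> injective (tnth s).
Proof.
move=> s_sorted; apply/tuple_uniqP.
have := sorted_uniq ltn_trans ltnn s_sorted.
by rewrite map_inj_uniq //; apply: val_inj.
Qed.

(** An injective map factors uniquely as a permutation followed by an increasing enumeration of its
    image. *)
Lemma sum_injective_sorted (F : {ffun 'I_p -> 'I_N} -> R) :
  \sum_(f : {ffun 'I_p -> 'I_N} | injectiveb f) F f =
    \sum_(s : p.-tuple 'I_N | sorted ltn [seq val r | r <- s])
      \sum_(t : 'S_p) F [ffun i => tnth s (t i)].
Proof.
pose le2 := relpre val leq : rel 'I_N.
have sort_sz (f : {ffun 'I_p -> 'I_N}) : size (sort le2 (codom f)) == p.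
  by rewrite size_sort size_codom card_ord.
pose srt f := Tuple (sort_sz f).
rewrite (partition_big srt (fun s => sorted ltn [seq val r | r <- s])) /=; last first.
  move=> f f_inj; rewrite /srt /= ltn_sorted_uniq_leq map_inj_uniq; last exact: val_inj.
  rewrite sort_uniq [uniq _]f_inj /= sorted_map; apply: sort_sorted => a b.
  exact: leq_total.
apply: eq_bigr => s s_sorted.
have s_inj := sorted_ltn_inj s_sorted.
pose H (t : 'S_p) := [ffun i => tnth s (t i)].
have H_inj : injective H.
  by move=> t u /ffunP E; apply/permP => i; apply: s_inj; have := E i; rewrite !ffunE.
rewrite -(big_imset (fun f => F f) (in2W H_inj)) /=.
(* The fibre of [srt] over s consists exactly of the rearrangements [H t] of s. *)
apply: eq_bigl => f; apply/andP/imsetP => [[f_inj /eqP srtf]|[t _ ->]].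
  have : perm_eq [tuple f i | i < p] s.
    by rewrite -srtf /= perm_sym perm_sort /codom /image_mem enumT perm_refl.
  case/tuple_permP => t /= E; exists t => //; apply/ffunP => i; rewrite ffunE.
  by move/eq_in_map: E => /(_ i (mem_enum _ i)).
have Hti : injective (H t) by move=> i j; rewrite !ffunE => /s_inj /perm_inj.
split; first exact/injectiveP.
apply/eqP/val_inj => /=.
apply: (@sorted_eq _ le2).
- by move=> a b c; exact: leq_trans.
- by move=> a b /andP[? ?]; apply/val_inj/eqP; rewrite eqn_leq; apply/andP.
- by apply: sort_sorted => a b; exact: leq_total.
- by move: s_sorted; rewrite ltn_sorted_uniq_leq sorted_map => /andP[].
rewrite perm_sort.
by apply/tuple_permP; exists t; apply: eq_map => i; rewrite ffunE.
Qed.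

(** Maps that are not injective select a repeated row and contribute nothing. For the others,
    sorting the rows of B costs the sign of t, and these signs build the Leibniz formula for the
    minor of A. *)
Lemma Cauchy_Binet A B :
  \det (A *m B) =
    \sum_(s : p.-tuple 'I_N | sorted ltn [seq val r | r <- s])
      \det (colsub (tnth s) A) * \det (rowsub (tnth s) B).
Proof.
rewrite det_mulmx_ffun (bigID (fun f : {ffun 'I_p -> 'I_N} => injectiveb f)) /=.
rewrite [X in _ + X]big1 ?addr0 => [|f /injectivePn[i [j ij fij]]]; last first.
  by rewrite (determinant_alternate ij) ?mul0r // => k; rewrite !mxE fij.
rewrite sum_injective_sorted; apply: eq_bigr => s _.
rewrite [\det (colsub _ _)]/determinant big_distrl /=; apply: eq_bigr => t _.
have -> : rowsub [ffun i => tnth s (t i)] B = row_perm t (rowsub (tnth s) B).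
  by apply/matrixP => i j; rewrite !mxE ffunE.
rewrite row_permE det_mulmx det_perm -!mulrA; congr (_ * _).
by rewrite mulrC; congr (_ * _); apply: eq_bigr => i _; rewrite !mxE ffunE.
Qed.

End CauchyBinet.

(** * Grouping row selections by the number of rows taken from each block *)

Section LambdaSum.
Variables (m J p : nat).

Lemma in_blockE (k : 'I_m) (r : 'I_(m * J)) : in_block k r = (row_block r == k).
Proof.
have J_gt0 : (0 < J)%N by exact: leq_ltn_trans (row_cat_subproof r).
by rewrite /in_block -leq_divRL // -ltn_divLR // ltnS -eqn_leq eq_sym.
Qed.

Lemma sum_block_card (s : p.-tuple 'I_(m * J)) :
  (\sum_(k < m) #|[set l : 'I_p | in_block k (tnth s l)]%SET|)%N = p.
Proof.
rewrite -[RHS]card_ord -sum1_card.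
rewrite (partition_big (fun l => row_block (tnth s l)) predT) //=.
apply: eq_bigr => k _; rewrite -sum1_card.
by apply: eq_bigl => l; rewrite inE in_blockE.
Qed.

(** Every selection lies in exactly one [Lambda], that of its own block counts. These are at most p,
    which is why alpha can range over the finite type of maps into ['I_p.+1]. *)
Lemma sum_sorted_Lambda (R : nmodType) (F : p.-tuple 'I_(m * J) -> R) :
  \sum_(s : p.-tuple 'I_(m * J) | sorted ltn [seq val r | r <- s]) F s =
    \sum_(alpha : {ffun 'I_m -> 'I_p.+1}
            | (\sum_(i < m) (alpha i : nat) == p)%N)
      \sum_(s in Lambda p (fun i => nat_of_ord (alpha i))) F s.
Proof.
pose cnt (s : p.-tuple 'I_(m * J)) k :=
  #|[set l : 'I_p | in_block k (tnth s l)]%SET|.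
have cnt_lt s k : (cnt s k < p.+1)%N.
  by rewrite ltnS (leq_trans (max_card _)) // card_ord.
rewrite (partition_big (fun s => [ffun k => Ordinal (cnt_lt s k)])
           (fun alpha => \sum_(i < m) (alpha i : nat) == p)%N) /=; last first.
  move=> s _; apply/eqP; rewrite -[RHS](sum_block_card s).
  by apply: eq_bigr => k _; rewrite ffunE.
apply: eq_bigr => alpha _; apply: eq_bigl => s; rewrite inE; congr (_ && _).
apply/eqP/forallP => [<- k|E]; first by rewrite ffunE /= eqxx.
by apply/ffunP => k; apply: val_inj; rewrite ffunE; exact/eqP/E.
Qed.

Lemma prod_Lambda (R : comPzSemiRingType) (alpha : 'I_m -> nat)
    (s : p.-tuple 'I_(m * J)) (w : 'I_m -> R) (u : 'I_m -> 'I_J -> R) :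
  s \in Lambda p alpha ->
  (\prod_(k < m | (0 < alpha k)%N)
     \prod_(l < p | in_block k (tnth s l)) u k (row_cat (tnth s l)))
    * \prod_(k < m) w k ^+ alpha k
  = \prod_(l < p) (w (row_block (tnth s l))
                   * u (row_block (tnth s l)) (row_cat (tnth s l))).
Proof.
rewrite inE => /andP[_ /forallP cnt].
rewrite [RHS](partition_big (fun l => row_block (tnth s l)) predT) //=.
rewrite [X in X * _]big_mkcond -big_split /=; apply: eq_bigr => k _.
have ak := eqP (cnt k).
have -> : w k ^+ alpha k = \prod_(l < p | in_block k (tnth s l)) w k.
  by rewrite -ak prodr_const; congr (_ ^+ _); apply: eq_card => l; rewrite inE.
transitivity ((\prod_(l < p | in_block k (tnth s l)) u k (row_cat (tnth s l)))
   * \prod_(l < p | in_block k (tnth s l)) w k).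
  (* If alpha_k = 0, no selected row lies in block k, so the product skipped on the left is
     empty. *)
  case: posnP => // ak0; congr (_ * _); rewrite big1 // => l lk.
  move: ak; rewrite ak0 => /eqP; rewrite cards_eq0 => /eqP/setP/(_ l).
  by rewrite !inE lk.
rewrite -big_split /=; apply: eq_big => [l|l]; first by rewrite in_blockE.
by rewrite in_blockE => /eqP ->; rewrite mulrC.
Qed.

End LambdaSum.

(** * Multinomial moments *)

Section MultinomialMoments.
Variables (R : realType) (J B : nat) (q : 'cV[R]_J).
Hypothesis q_total : \sum_j q j 0 = 1.

(* Outcomes of at most B trials are encoded in a finite type, so that moments are
   finite sums; multinomial_pmf vanishes at the other encoded vectors. *)
Definition counts_of (y : {ffun 'I_J -> 'I_B.+1}) : J.-tuple nat :=
  [tuple nat_of_ord (y j) | j < J].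

Local Notation pmf N y := (multinomial_pmf N q (counts_of y)).

(** Absorption identity for multinomial coefficients, from y_j! = y_j (y_j - 1)!. It trades a factor
    y_j for one trial fewer, and all moments below follow from it. *)
Lemma multinomial_pmf_absorb N (j : 'I_J) (y y' : J.-tuple nat) :
  (forall k, tnth y k = (tnth y' k + (k == j))%N) ->
  (tnth y j)%:R * multinomial_pmf N.+1 q y =
    N.+1%:R * q j 0 * multinomial_pmf N q y'.
Proof.
move=> yy'; rewrite /multinomial_pmf.
have -> : (\sum_(k < J) tnth y k = (\sum_(k < J) tnth y' k).+1)%N.
  under eq_bigr do rewrite yy'.
  rewrite big_split /= -addn1; congr (_ + _)%N.
  by rewrite (bigD1 j) //= eqxx big1 // => k /negPf ->.
rewrite eqSS; case: eqP => _; last by rewrite !mulr0.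
rewrite (bigD1 j) //= [in RHS](bigD1 j) //= [\prod_k q k 0 ^+ tnth y k](bigD1 j) //=.
rewrite [\prod_k q k 0 ^+ tnth y' k](bigD1 j) //=.
rewrite [X in (_ * X)%N](eq_bigr (fun k => (tnth y' k)`!)); last first.
  by move=> k /negPf kj; rewrite yy' kj addn0.
rewrite [X in _ / _ * (_ * X)](eq_bigr (fun k => q k 0 ^+ tnth y' k)); last first.
  by move=> k /negPf kj; rewrite yy' kj addn0.
rewrite !yy' eqxx addn1 exprS !factS !natrM.
set P := (\prod_(i < J | i != j) _)%N.
have P0 : P%:R != 0 :> R.
  by rewrite pnatr_eq0 -lt0n prodn_gt0 // => k; rewrite fact_gt0.
have y0 : (tnth y' j)`!%:R != 0 :> R by rewrite pnatr_eq0 -lt0n fact_gt0.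
have y1 : (tnth y' j).+1%:R != 0 :> R by rewrite pnatr_eq0.
by field; rewrite P0 y0 nat1r y1.
Qed.

(** Adding one count in category j is a bijection from the outcomes of N trials onto those of N + 1
    trials with y_j > 0. The strict bound keeps the shifted outcome within the encoding. *)
Lemma sum_multinomial_absorb N (j : 'I_J) (f : J.-tuple nat -> R) : (N < B)%N ->
  \sum_y (tnth (counts_of y) j)%:R * pmf N.+1 y * f (counts_of y) =
    N.+1%:R * q j 0 * \sum_y pmf N y *
       f [tuple tnth (counts_of y) k + (k == j) | k < J]%N.
Proof.
move=> NB.
rewrite mulr_sumr.
have sum_cnt y : (\sum_(k < J) tnth (counts_of y) k = \sum_(k < J) y k)%N.
  by apply: eq_bigr => k _; rewrite tnth_mktuple.
pose up (y : {ffun 'I_J -> 'I_B.+1}) : {ffun 'I_J -> 'I_B.+1} :=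
  [ffun k => inord (y k + (k == j))].
pose dn (y : {ffun 'I_J -> 'I_B.+1}) : {ffun 'I_J -> 'I_B.+1} :=
  [ffun k => inord (y k - (k == j))].
have leB (y : {ffun 'I_J -> 'I_B.+1}) k : (\sum_(k < J) y k == N -> y k < B)%N.
  by move/eqP => yN; apply: leq_ltn_trans NB; rewrite -yN (bigD1 k) //= leq_addr.
(* Terms with y_j = 0 vanish through the factor y_j, those with a wrong total through the pmf. *)
rewrite (bigID (fun y : {ffun 'I_J -> 'I_B.+1} =>
  (\sum_(k < J) y k == N.+1) && (0 < y j))%N) /=.
rewrite [X in _ + X]big1 ?addr0; last first.
  move=> y; rewrite negb_and => /orP[yN|yj].
    by rewrite /multinomial_pmf sum_cnt (negPf yN) mulr0 mul0r.
  by rewrite tnth_mktuple; move: yj; rewrite -eqn0Ngt => /eqP ->; rewrite !mul0r.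
rewrite [RHS](bigID (fun y : {ffun 'I_J -> 'I_B.+1} => \sum_(k < J) y k == N)%N) /=.
rewrite [X in _ = _ + X]big1 ?addr0; last first.
  by move=> y yN; rewrite /multinomial_pmf sum_cnt (negPf yN) mul0r mulr0.
(* [inord] returns the intended value here, because a total of N < B leaves room for one more
   count. *)
have upE (y : {ffun 'I_J -> 'I_B.+1}) k :
    (\sum_(k < J) y k == N)%N -> up y k = (y k + (k == j))%N :> nat.
  move=> yN; rewrite ffunE inordK // ltnS.
  by have := leB y k yN; case: (k == j); rewrite ?addn1 ?addn0 // => /ltnW.
have dnE (y : {ffun 'I_J -> 'I_B.+1}) k : dn y k = (y k - (k == j))%N :> nat.
  by rewrite ffunE inordK // ltnS (leq_trans (leq_subr _ _)) // -ltnS ltn_ord.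
rewrite (reindex_onto up dn) /=; last first.
  move=> y /andP[/eqP yN yj]; apply/ffunP => k; apply: val_inj => /=.
  rewrite [in LHS]ffunE inordK; rewrite dnE.
    by case: eqP => [->|]; rewrite ?subn0 ?addn0 // subnK.
  by case: eqP => [->|]; rewrite ?subn0 ?addn0 ?subnK // ltn_ord.
have sum_e : (\sum_(k < J) (k == j) = 1)%N.
  by rewrite (bigD1 j) //= eqxx big1 // => k /negPf ->.
have dn_sum (z : {ffun 'I_J -> 'I_B.+1}) : (0 < z j)%N ->
    ((\sum_(k < J) dn z k).+1 = \sum_(k < J) z k)%N.
  move=> zj; rewrite -addn1 -[X in (_ + X)%N]sum_e -big_split /=.
  apply: eq_bigr => k _; rewrite dnE.
  by case: eqP => [->|]; rewrite ?subn0 ?addn0 // subnK.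
have upN y : (\sum_(k < J) up y k == N.+1)%N && (0 < up y j)%N && (dn (up y) == y) ->
    (\sum_(k < J) y k == N)%N.
  by move=> /andP[/andP[yN yj] /eqP yK]; rewrite -{1}yK -eqSS dn_sum.
apply: eq_big => [y|y /upN yN].
  apply/idP/idP => [/upN //|yN]; rewrite upE // eqxx addn1 /= andbT.
  apply/andP; split.
    under eq_bigr do rewrite upE //.
    by rewrite big_split /= (eqP yN) sum_e addn1.
  by apply/eqP/ffunP => k; apply: val_inj; rewrite /= dnE upE // addnK.
have cE : counts_of (up y) = [tuple tnth (counts_of y) k + (k == j) | k < J]%N.
  by apply: eq_from_tnth => k; rewrite !tnth_mktuple upE.
rewrite (@multinomial_pmf_absorb N j _ (counts_of y)) ?cE ?mulrA // => k.
by rewrite tnth_mktuple.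
Qed.

Lemma multinomial_pmf0 (y : J.-tuple nat) :
  (\sum_(j < J) tnth y j = 0)%N -> multinomial_pmf 0 q y = 1.
Proof.
move=> y0; rewrite /multinomial_pmf y0 eqxx; move/eqP: y0.
rewrite sum_nat_eq0 => /forallP/= y0.
rewrite !big1 => [|k _|k _]; rewrite ?(eqP (y0 k)) ?expr0 //.
by rewrite fact0 divr1 mulr1.
Qed.

Lemma sum_multinomial_pmf N : (N <= B)%N -> \sum_y pmf N y = 1.
Proof.
elim: N => [_|N IHN NB].
  rewrite (bigD1 [ffun=> ord0]) //= big1 ?addr0 => [|y].
    by apply: multinomial_pmf0; apply: big1 => k _; rewrite tnth_mktuple ffunE.
  apply: contra_neqP; rewrite /multinomial_pmf; case: ifP => // /eqP s0 _.
  apply/ffunP => k; rewrite ffunE; apply: val_inj => /=; move/eqP: s0.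
  by rewrite sum_nat_eq0 => /forallP/(_ k)/eqP; rewrite tnth_mktuple.
have N0 : N.+1%:R != 0 :> R by rewrite pnatr_eq0.
apply: (mulfI N0); rewrite mulr1 mulr_sumr.
(* Where the pmf is nonzero the counts sum to N + 1, so this factor splits over the categories and
   each part can be absorbed. *)
transitivity (\sum_j \sum_y (tnth (counts_of y) j)%:R * pmf N.+1 y * 1).
  rewrite exchange_big /=; apply: eq_bigr => y _.
  rewrite -mulr_suml -mulr_suml mulr1 -natr_sum.
  by rewrite /multinomial_pmf; case: eqP => [->|]; rewrite ?mulr0.
under eq_bigr => j _.
  rewrite (@sum_multinomial_absorb N j (fun=> 1)) //.
  under eq_bigr do rewrite mulr1.
  rewrite IHN ?mulr1; last exact: ltnW.
over.
by rewrite -mulr_sumr q_total mulr1.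
Qed.

Lemma multinomial_mean N (j : 'I_J) : (N <= B)%N ->
  \sum_y pmf N y * (tnth (counts_of y) j)%:R = N%:R * q j 0.
Proof.
case: N => [_|N NB].
  rewrite mul0r big1 // => y _; rewrite /multinomial_pmf; case: ifP; rewrite ?mul0r //.
  by rewrite sum_nat_eq0 => /forallP/(_ j)/eqP ->; rewrite mulr0.
have := @sum_multinomial_absorb N j (fun=> 1) NB.
under eq_bigr do rewrite mulr1 mulrC.
by under [X in _ * X]eq_bigr do rewrite mulr1; rewrite sum_multinomial_pmf ?mulr1 // ltnW.
Qed.

Lemma multinomial_second_moment N (j k : 'I_J) : (N <= B)%N ->
  \sum_y pmf N y * (tnth (counts_of y) j)%:R * (tnth (counts_of y) k)%:R
  = N%:R * (N%:R - 1) * q j 0 * q k 0 + N%:R * q j 0 * (j == k)%:R.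
Proof.
case: N => [_|N NB].
  rewrite !mul0r addr0 big1 // => y _; rewrite /multinomial_pmf; case: ifP; rewrite ?mul0r //.
  by rewrite sum_nat_eq0 => /forallP/(_ j)/eqP ->; rewrite mulr0 mul0r.
have := @sum_multinomial_absorb N j (fun y => (tnth y k)%:R) NB.
under eq_bigr do rewrite [_ * multinomial_pmf _ _ _]mulrC.
move=> ->.
(* After absorption the second count reads y_k + [k = j]; the bracket produces the diagonal term. *)
under [X in _ * X]eq_bigr do rewrite tnth_mktuple natrD mulrDr.
rewrite big_split /= multinomial_mean ?(ltnW NB) // -mulr_suml.
rewrite sum_multinomial_pmf ?(ltnW NB) // -natr1 eq_sym; ring.
Qed.

(* For centred linear forms only the diagonal part of the covariance matrix
   N (diag q - q q^T) contributes. *)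
Lemma multinomial_centred_moment N (a b : 'I_J -> R) : (N <= B)%N ->
  \sum_j q j 0 * a j = 0 ->
  \sum_y pmf N y * (\sum_j (tnth (counts_of y) j)%:R * a j)
                 * (\sum_j (tnth (counts_of y) j)%:R * b j)
  = N%:R * \sum_j q j 0 * a j * b j.
Proof.
move=> NB a0.
transitivity (\sum_j \sum_k a j * b k *
   \sum_y pmf N y * (tnth (counts_of y) j)%:R * (tnth (counts_of y) k)%:R).
  under [RHS]eq_bigr => j _ do under eq_bigr => k _ do rewrite mulr_sumr.
  under [RHS]eq_bigr => j _ do rewrite exchange_big.
  rewrite [RHS]exchange_big /=; apply: eq_bigr => y _.
  rewrite -mulrA big_distrlr /= mulr_sumr; apply: eq_bigr => j _; rewrite mulr_sumr.
  by apply: eq_bigr => k _; ring.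
transitivity (\sum_j (N%:R * (N%:R - 1) * (\sum_k q k 0 * b k) * (q j 0 * a j)
    + N%:R * (q j 0 * a j * b j))).
  apply: eq_bigr => j _.
  under eq_bigr do rewrite multinomial_second_moment // mulrDr.
  rewrite big_split /=; congr (_ + _).
    by rewrite mulr_sumr mulr_suml; apply: eq_bigr => k _; ring.
  rewrite (bigD1 j) //= big1 ?addr0 => [|k /negPf]; first by rewrite eqxx mulr1; ring.
  by rewrite eq_sym => ->; rewrite !mulr0.
by rewrite big_split /= -mulr_sumr a0 mulr0 add0r -mulr_sumr.
Qed.

End MultinomialMoments.

(** * Logit equations *)

Section LogitSystem.
Variables (R : realType) (J : nat) (lt : logit_type).
Local Notation nu j v := (\sum_(k in nu_cat lt j) v k 0).
Local Notation delta j v := (\sum_(k in delta_cat lt j) v k 0).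
Implicit Types (E : 'rV[R]_(J.-1 + J.-1 + 1)) (v q : 'cV[R]_J).

Lemma L_mx_nu v (j : 'I_J.-1) :
  (L_mx lt *m v) (lshift 1 (lshift J.-1 j)) 0 = nu j v.
Proof.
rewrite /L_mx mul_col_mx col_mxEu mul_col_mx col_mxEu mxE [RHS]big_mkcond /=.
by apply: eq_bigr => k _; rewrite mxE; case: ifP => _; rewrite ?mul1r ?mul0r.
Qed.

Lemma L_mx_delta v (j : 'I_J.-1) :
  (L_mx lt *m v) (lshift 1 (rshift J.-1 j)) 0 = delta j v.
Proof.
rewrite /L_mx mul_col_mx col_mxEu mul_col_mx col_mxEd mxE [RHS]big_mkcond /=.
by apply: eq_bigr => k _; rewrite mxE; case: ifP => _; rewrite ?mul1r ?mul0r.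
Qed.

Lemma L_mx_total v (j : 'I_1) :
  (L_mx lt *m v) (rshift (J.-1 + J.-1) j) 0 = \sum_k v k 0.
Proof.
rewrite /L_mx mul_col_mx col_mxEd mxE.
by apply: eq_bigr => k _; rewrite mxE mul1r.
Qed.

(** The diagonal is left free so that one nonsingularity result serves twice: for the inverse of L
    pi, as in the definition of c_ij, and for [odds_row], as in the equations that determine pi. *)
Definition logit_mx E : 'M[R]_J := CT_mx *m diag_mx E *m L_mx lt.

Lemma pid_mx_mulE n1 n2 (y : 'cV[R]_n1) (a : 'I_n2) :
  (pid_mx n1 *m y) a 0 = if insub (a : nat) is Some j then y j 0 else 0.
Proof.
rewrite mxE; case: insubP => [j _ ja|].
  rewrite (bigD1 j) //= big1 ?addr0 => [|k kj]; rewrite mxE -ja.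
    by rewrite eqxx ltn_ord mul1r.
  by rewrite eq_sym (inj_eq val_inj) (negPf kj) mul0r.
rewrite -leqNgt => an; apply: big1 => k _; rewrite mxE.
by rewrite eqn_leq leqNgt (leq_trans (ltn_ord k) an) mul0r.
Qed.

(** [insub] fails exactly at a = J - 1, so it separates the logit rows from the final row for the
    total. *)
Lemma CT_mxE (y : 'cV[R]_(J.-1 + J.-1 + 1)) (a : 'I_J) :
  (CT_mx *m y) a 0 =
    if insub (a : nat) is Some j
    then y (lshift 1 (lshift J.-1 j)) 0 - y (lshift 1 (rshift J.-1 j)) 0
    else y (rshift (J.-1 + J.-1) 0) 0.
Proof.
rewrite /CT_mx -[y in LHS]vsubmxK mul_row_col [LHS]mxE.
rewrite -[usubmx y in LHS]vsubmxK mul_row_col [X in X + _]mxE mulNmx.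
rewrite [X in _ + X + _]mxE !pid_mx_mulE [X in _ + X]mxE big_ord1.
rewrite [X in _ + X * _]mxE [X in _ + _ * X]mxE.
case: insubP => [j aJ ja|].
  rewrite !mxE; have -> : (a.+1 == J) = false.
    by apply/negbTE; rewrite neq_ltn -ltn_predRL aJ.
  by rewrite mul0r addr0.
rewrite -leqNgt => Ja; rewrite subr0 add0r.
have -> : a.+1 == J.
  by rewrite eqn_leq ltn_ord /= (leq_trans (leqSpred _)).
by rewrite mul1r.
Qed.

Lemma logit_mxE E v (a : 'I_J) :
  (logit_mx E *m v) a 0 =
    if insub (a : nat) is Some j
    then E 0 (lshift 1 (lshift J.-1 j)) * nu j v
           - E 0 (lshift 1 (rshift J.-1 j)) * delta j v
    else E 0 (rshift (J.-1 + J.-1) 0) * \sum_k v k 0.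
Proof.
rewrite /logit_mx -!mulmxA CT_mxE mul_diag_mx !mxE -/(mulmx _ _).
have dE r : (\row_i E 0 i *m 0) 0 r = 0 :> R by rewrite mulmx0 mxE.
have mE r : \sum_j L_mx lt r j * v j 0 = (L_mx lt *m v) r 0 by rewrite mxE.
by case: insubP => [j _ _|_]; rewrite ?mxE ?mE ?L_mx_nu ?L_mx_delta ?L_mx_total.
Qed.

End LogitSystem.

(** * Nonsingularity of the logit equations for positive odds *)

Lemma unitmx_ker0 (F : fieldType) n (A : 'M[F]_n) :
  (forall v : 'cV_n, A *m v = 0 -> v = 0) -> A \in unitmx.
Proof.
move=> A_inj; rewrite unitmxE unitfE -det_tr; apply/det0P => -[v /negP v0 vA].
apply: v0; rewrite -trmx_eq0; apply/eqP/A_inj.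
by apply: trmx_inj; rewrite trmx_mul trmxK trmx0.
Qed.

Section LogitKernel.
Variables (R : realType) (K : nat) (v : 'cV[R]_K.+1).
Hypothesis v_total : \sum_k v k 0 = 0.

(** Summing the coordinates gives zero as a positive multiple of the last one, which therefore
    vanishes and takes the others with it. *)
Lemma ker0_proportional :
  (forall k, exists2 c, 0 < c & v k 0 = c * v ord_max 0) -> v = 0.
Proof.
move=> vc; have /choice[c cP] : forall k, exists c, 0 < c /\ v k 0 = c * v ord_max 0.
  by move=> k; have [c c0 ck] := vc k; exists c.
have v_max : v ord_max 0 = 0.
  move: v_total; under eq_bigr do rewrite (cP _).2.
  rewrite -mulr_suml => /eqP; rewrite mulf_eq0 => /orP[|/eqP //].
  rewrite psumr_eq0 => [/allP/(_ ord_max (mem_index_enum _))|k _]; last exact/ltW/(cP k).1.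
  by rewrite /= gt_eqF // (cP _).1.
by apply/colP => k; rewrite (cP k).2 v_max mulr0 mxE.
Qed.

(** Consecutive tails differ by one coordinate; the tail that starts at 0 is the total. *)
Lemma ker0_tail :
  (forall j, (j < K)%N -> \sum_(k : 'I_K.+1 | (j < k)%N) v k 0 = 0) -> v = 0.
Proof.
move=> tail0; apply/colP => k; rewrite mxE.
have tail_ge (n : 'I_K.+1) : \sum_(k0 : 'I_K.+1 | (n <= k0)%N) v k0 0 = 0.
  case: n => -[|n] nK /=; first by under eq_bigl do rewrite leq0n.
  exact: tail0.
have tail_gt (n : 'I_K.+1) : \sum_(k0 : 'I_K.+1 | (n < k0)%N) v k0 0 = 0.
  have [nK|Kn] := ltnP n K; first exact: tail0.
  rewrite big1 // => k0 nk0; have := leq_ltn_trans Kn nk0.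
  by rewrite ltnNge -ltnS ltn_ord.
have := tail_ge k; rewrite (bigD1 k) //= -[RHS](tail_gt k) => E.
apply: (addIr (\sum_(k0 : 'I_K.+1 | (k < k0)%N) v k0 0)).
rewrite add0r -[RHS]E; congr (_ + _); apply: eq_bigl => i.
by rewrite ltn_neqAle eq_sym andbC -(inj_eq val_inj) /= eq_sym.
Qed.

Lemma sum_single (n : 'I_K.+1) :
  \sum_(k in [set k : 'I_K.+1 | k == n :> nat]%SET) v k 0 = v n 0.
Proof. by under eq_bigl => k do rewrite inE (inj_eq val_inj); rewrite big_pred1_eq. Qed.

Variables (lt : logit_type) (a b : 'I_K -> R).
Hypotheses (a_gt0 : forall j, 0 < a j) (b_gt0 : forall j, 0 < b j).
Hypothesis v_logit : forall j : 'I_K,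
  a j * (\sum_(k in @nu_cat lt K.+1 j) v k 0)
  = b j * (\sum_(k in @delta_cat lt K.+1 j) v k 0).

Let lastE : \sum_(k in [set k : 'I_K.+1 | k.+1 == K.+1]%SET) v k 0 = v ord_max 0.
Proof. by rewrite -sum_single; apply: eq_bigl => k; rewrite !inE. Qed.

Let curE (j : 'I_K) :
  \sum_(k in [set k : 'I_K.+1 | k == j :> nat]%SET) v k 0 = v (widen_ord (leqnSn K) j) 0.
Proof. by rewrite -sum_single. Qed.

Let nextE (j : 'I_K) :
  \sum_(k in [set k : 'I_K.+1 | k == j.+1 :> nat]%SET) v k 0 = v (lift ord0 j) 0.
Proof. by rewrite -sum_single. Qed.

Let tailE (j : 'I_K) :
  \sum_(k in [set k : 'I_K.+1 | (j < k)%N]%SET) v k 0 = \sum_(k : 'I_K.+1 | (j < k)%N) v k 0.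
Proof. by apply: eq_bigl => k; rewrite inE. Qed.

Lemma logit_ker0 : v = 0.
Proof.
case: lt v_logit => /= vE.
- apply: ker0_proportional => k; have [kK|Kk] := ltnP k K; last first.
    exists 1; rewrite ?mul1r //; congr (v _ _); apply/val_inj/eqP.
    by rewrite eqn_leq Kk -ltnS ltn_ord.
  have := vE (Ordinal kK); rewrite curE lastE => E.
  exists (b (Ordinal kK) / a (Ordinal kK)); first exact: divr_gt0.
  have -> : v k 0 = v (widen_ord (leqnSn K) (Ordinal kK)) 0.
    by congr (v _ _); exact: val_inj.
  by rewrite mulrAC -E mulrAC mulfV ?mul1r // gt_eqF.
- apply: ker0_tail => n nK; pose j := Ordinal nK; have := vE j; rewrite tailE.
  (* The total is zero, so the head is minus the tail and the equation becomes (a + b) * tail =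
     0. *)
  have -> : \sum_(k in [set k : 'I_K.+1 | (k <= j)%N]%SET) v k 0
            = - \sum_(k : 'I_K.+1 | (j < k)%N) v k 0.
    apply/eqP; rewrite -subr_eq0 opprK -[X in _ == X]v_total eq_sym.
    rewrite (bigID (fun k : 'I_K.+1 => (k <= j)%N)) /=; apply/eqP; congr (_ + _).
      by apply: eq_bigl => k; rewrite inE.
    by apply: eq_bigl => k; rewrite ltnNge.
  rewrite mulrN => /eqP; rewrite eq_sym -subr_eq0 opprK -mulrDl mulf_eq0.
  by rewrite gt_eqF ?addr_gt0 //= => /eqP.
- apply: ker0_proportional => k.
  (* Downward induction on k, from the last category; each step multiplies the constant by a ratio b
     / a. *)
  have [n nE] : exists n, n = (K - k)%N by exists (K - k)%N.
  elim: n k nE => [|n IHn] k nE.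
    exists 1; rewrite ?mul1r //; congr (v _ _); apply/val_inj/eqP.
    by rewrite /= eqn_leq -ltnS ltn_ord -subn_eq0 -nE.
  have kK : (k < K)%N by rewrite -subn_gt0 -nE.
  have [|c c_gt0 cE] := IHn (lift ord0 (Ordinal kK)).
    by rewrite /= /bump /= add1n subnS -nE.
  have := vE (Ordinal kK); rewrite curE nextE cE => E.
  exists (b (Ordinal kK) / a (Ordinal kK) * c).
    by rewrite mulr_gt0 // divr_gt0.
  have -> : v k 0 = v (widen_ord (leqnSn K) (Ordinal kK)) 0.
    by congr (v _ _); exact: val_inj.
  apply: (mulfI (lt0r_neq0 (a_gt0 (Ordinal kK)))); rewrite E.
  by field; exact: lt0r_neq0.
(* A vanishing tail makes its first coordinate minus the next tail, so again (a + b) * tail = 0. The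
   induction starts from the zero total. *)
- apply: ker0_tail; elim=> [|n IHn] nK.
    have := vE (Ordinal nK); rewrite curE tailE /=.
    have E0 := v_total; rewrite big_ord_recl in E0.
    have -> : \sum_(k : 'I_K.+1 | (0 < k)%N) v k 0 = \sum_(i < K) v (lift ord0 i) 0.
      by rewrite big_mkcond big_ord_recl /= add0r; apply: eq_bigr.
    have -> : widen_ord (leqnSn K) (Ordinal nK) = ord0 by exact: val_inj.
    move/eqP: E0; rewrite addr_eq0 => /eqP ->.
    rewrite mulrN => /eqP; rewrite eq_sym -subr_eq0 opprK -mulrDl mulf_eq0.
    by rewrite gt_eqF ?addr_gt0 //= => /eqP.
  have := IHn (ltnW nK); rewrite (bigD1 (widen_ord (leqnSn K) (Ordinal nK))) //=.
  have := vE (Ordinal nK); rewrite curE tailE /=.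
  have -> : \sum_(i : 'I_K.+1 | (n < i)%N && (i != widen_ord (leqnSn K) (Ordinal nK))) v i 0
     = \sum_(k : 'I_K.+1 | (n.+1 < k)%N) v k 0.
    by apply: eq_bigl => i; rewrite [RHS]ltn_neqAle andbC eq_sym.
  move=> E /eqP; rewrite addr_eq0 => /eqP E0; move: E; rewrite E0.
  rewrite mulrN => /eqP; rewrite eq_sym -subr_eq0 opprK -mulrDl mulf_eq0.
  by rewrite gt_eqF ?addr_gt0 //= => /eqP.
Qed.

End LogitKernel.

Lemma logit_mx_unit (R : realType) (J : nat) (lt : logit_type)
    (E : 'rV[R]_(J.-1 + J.-1 + 1)) :
  (forall r, 0 < E 0 r) -> logit_mx lt E \in unitmx.
Proof.
move=> E_gt0; apply: unitmx_ker0; case: J E E_gt0 => [|K] E E_gt0 v.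
  by move=> _; apply/matrixP => -[].
move/colP => Ev.
apply: (logit_ker0 _ (a := fun j => E 0 (lshift 1 (lshift K j)))
  (b := fun j => E 0 (lshift 1 (rshift K j))) _ _ (lt := lt)) => //.
  have := Ev ord_max; rewrite logit_mxE insubN ?ltnn // mxE => /eqP.
  by rewrite mulf_eq0 gt_eqF //= => /eqP.
move=> j; have := Ev (widen_ord (leqnSn K) j).
rewrite logit_mxE; case: insubP => [j' _ /= jj'|]; last by rewrite /= ltn_ord.
have -> : j' = j by exact: val_inj.
by rewrite mxE => /eqP; rewrite subr_eq0 => /eqP.
Qed.

(** * Derivatives of the category probabilities *)

Section DerivableMatrix.
Variables (R : realType).
Implicit Types x : R.

Lemma is_derive_bigsum (I : Type) (r : seq I) (Q : pred I) (f : I -> R -> R)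
    (df : I -> R) x : (forall i, Q i -> is_derive x 1 (f i) (df i)) ->
  is_derive x 1 (fun s => \sum_(i <- r | Q i) f i s) (\sum_(i <- r | Q i) df i).
Proof.
move=> fx; elim: r => [|i r IHr].
  by under eq_fun do rewrite big_nil; rewrite big_nil; exact: is_derive_cst.
under eq_fun do rewrite big_cons; rewrite big_cons.
by case: ifPn => // Qi; apply: is_deriveD; exact: fx.
Qed.

Lemma derivable_bigprod (I : Type) (r : seq I) (Q : pred I) (f : I -> R -> R) x :
  (forall i, derivable (f i) x 1) ->
  derivable (fun s => \prod_(i <- r | Q i) f i s) x 1.
Proof.
move=> df; elim: r => [|i r IHr].
  by under eq_fun do rewrite big_nil; exact: derivable_cst.
under eq_fun do rewrite big_cons.
by case: (Q i) => //; exact: derivableM.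
Qed.

Lemma derivable_det n (M : R -> 'M[R]_n) x :
  (forall i j, derivable (fun s => M s i j) x 1) ->
  derivable (fun s => \det (M s)) x 1.
Proof.
move=> dM; apply: ex_derive; apply: is_derive_bigsum => t _; apply: derivableP.
apply: derivableM; first exact: derivable_cst.
exact: derivable_bigprod.
Qed.

Lemma derivable_mulmx m n p (M : R -> 'M[R]_(m, n)) (N : R -> 'M[R]_(n, p)) x i k :
  (forall i j, derivable (fun s => M s i j) x 1) ->
  (forall i j, derivable (fun s => N s i j) x 1) ->
  derivable (fun s => (M s *m N s) i k) x 1.
Proof.
move=> dM dN; under eq_fun do rewrite mxE.
by apply: ex_derive; apply: is_derive_bigsum => j _; apply: derivableP; exact: derivableM.
Qed.

(** With a unit at every s, [invmx] unfolds everywhere to the adjugate formula, a quotient of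
    polynomials in the entries. *)
Lemma derivable_invmx n (M : R -> 'M[R]_n) x i j :
  (forall s, M s \in unitmx) ->
  (forall i j, derivable (fun s => M s i j) x 1) ->
  derivable (fun s => invmx (M s) i j) x 1.
Proof.
move=> uM dM; under eq_fun do rewrite /invmx uM !mxE.
apply: derivableM.
  by apply: derivableV (derivable_det dM); rewrite -unitfE -unitmxE.
apply: derivableM; first exact: derivable_cst.
apply: derivable_det => k l; under eq_fun do rewrite !mxE.
exact: dM.
Qed.

End DerivableMatrix.

Section CategoryProbabilities.
Variables (R : realType) (J : nat) (lt : logit_type).
Local Notation nu j v := (\sum_(k in nu_cat lt j) v k 0).
Local Notation delta j v := (\sum_(k in delta_cat lt j) v k 0).
Implicit Types (e : 'I_J.-1 -> R) (q v : 'cV[R]_J) (j : 'I_J.-1).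

Lemma nu_gt0 q j : (forall k, 0 < q k 0) -> 0 < nu j q.
Proof.
move=> q_gt0; rewrite (bigD1 (widen_ord (leq_pred J) j)) /=.
  by rewrite ltr_wpDr // sumr_ge0 // => k _; exact: ltW.
by case: lt; rewrite inE /=.
Qed.

Lemma delta_gt0 q j : (forall k, 0 < q k 0) -> 0 < delta j q.
Proof.
move=> q_gt0.
have [k kj] : exists k, k \in delta_cat lt j.
  case: J j => [[]|K] // j; case: lt => /=;
    [exists ord_max|exists (lift ord0 j)|exists (lift ord0 j)|exists (lift ord0 j)];
    by rewrite inE.
by rewrite (bigD1 k) //= ltr_wpDr // sumr_ge0 // => k' _; exact: ltW.
Qed.

(* The equations nu_j = exp(e_j) delta_j together with sum_k q_k = 1 form a
   linear system in q, with matrix logit_mx (odds_row e). *)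
Definition odds_row e : 'rV[R]_(J.-1 + J.-1 + 1) :=
  row_mx (row_mx (const_mx 1) (\row_j expR (e j))) (const_mx 1).

(** The right-hand side is 0 for the logit rows and 1 for the total. The solution exists for every
    e, but for cumulative logits it may fail to be positive. *)
Definition cat_prob e : 'cV[R]_J :=
  invmx (logit_mx lt (odds_row e)) *m \col_(a < J) (a.+1 == J)%:R.

Lemma odds_row_nu e j : odds_row e 0 (lshift 1 (lshift J.-1 j)) = 1.
Proof. by rewrite /odds_row !row_mxEl mxE. Qed.

Lemma odds_row_delta e j : odds_row e 0 (lshift 1 (rshift J.-1 j)) = expR (e j).
Proof. by rewrite /odds_row row_mxEl row_mxEr mxE. Qed.

Lemma odds_row_total e i : odds_row e 0 (rshift (J.-1 + J.-1) i) = 1.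
Proof. by rewrite /odds_row row_mxEr mxE. Qed.

Lemma odds_row_gt0 e r : 0 < odds_row e 0 r.
Proof.
case: (split_ordP r) => [r' ->|r' ->]; last by rewrite odds_row_total.
case: (split_ordP r') => [j ->|j ->]; first by rewrite odds_row_nu.
by rewrite odds_row_delta expR_gt0.
Qed.

Lemma logit_mx_oddsE e v (a : 'I_J) :
  (logit_mx lt (odds_row e) *m v) a 0 =
    if insub (a : nat) is Some j then nu j v - expR (e j) * delta j v
    else \sum_k v k 0.
Proof.
rewrite logit_mxE odds_row_total mul1r.
by case: insubP => // j _ _; rewrite odds_row_nu odds_row_delta mul1r.
Qed.

Lemma insub_ltn_pred (a : 'I_J) :
  (a.+1 == J) = (insub (a : nat) == None :> option 'I_J.-1).
Proof.
case: insubP => [j aJ _|]; first by apply/negbTE; rewrite neq_ltn -ltn_predRL aJ.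
by rewrite -leqNgt => Ja; rewrite eqn_leq ltn_ord /= (leq_trans (leqSpred _)).
Qed.

(** Positivity allows passing between the logarithm of a ratio and the linear equation;
    nonsingularity then leaves a single candidate. *)
Lemma cat_probP e q : (1 < J)%N -> (forall k, 0 < q k 0) ->
  (\sum_k q k 0 = 1 /\ forall j, ln (nu j q / delta j q) = e j)
    <-> q = cat_prob e.
Proof.
move=> J_gt1 q_gt0; have uE := logit_mx_unit lt (odds_row_gt0 e).
have sysE : (logit_mx lt (odds_row e) *m q = \col_(a < J) (a.+1 == J)%:R)
    <-> q = cat_prob e.
  split=> [Eq|->]; first by rewrite /cat_prob -Eq mulKmx.
  by rewrite /cat_prob mulKVmx.
rewrite -sysE; split=> [[q1 qe]|/colP Eq].
  apply/colP => a; rewrite logit_mx_oddsE mxE insub_ltn_pred.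
  case: insubP => // j _ _; rewrite -qe lnK; last first.
    by rewrite posrE divr_gt0 ?nu_gt0 ?delta_gt0.
  by rewrite divfK ?subrr // gt_eqF // delta_gt0.
split=> [|j].
  have J1 : (J.-1 < J)%N by rewrite ltn_predL ltnW.
  have := Eq (Ordinal J1).
  by rewrite logit_mx_oddsE mxE insub_ltn_pred /= insubN ?ltnn // eqxx.
have := Eq (widen_ord (leq_pred J) j).
rewrite logit_mx_oddsE mxE insub_ltn_pred.
case: insubP => [j' _ /= jj'|]; last by rewrite /= ltn_ord.
have -> : j' = j by exact: val_inj.
move/eqP; rewrite subr_eq0 => /eqP ->.
by rewrite mulfK ?expRK // gt_eqF // delta_gt0.
Qed.

Lemma derivable_cat_prob (e : R -> 'I_J.-1 -> R) x k :
  (forall j, derivable (fun s => e s j) x 1) ->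
  derivable (fun s => cat_prob (e s) k 0) x 1.
Proof.
move=> de; apply: derivable_mulmx => [i j|i j]; last exact: derivable_cst.
apply: derivable_invmx => [s|a b].
  exact/logit_mx_unit/odds_row_gt0.
rewrite /logit_mx; apply: derivable_mulmx => [c d|c d]; last exact: derivable_cst.
apply: derivable_mulmx => [c' d'|c' d']; first exact: derivable_cst.
under eq_fun do rewrite mxE.
suff dr r : derivable (fun s => odds_row (e s) 0 r) x 1.
  by case: (c' == d'); [under eq_fun do rewrite mulr1n|under eq_fun do rewrite mulr0n];
    [exact: dr|exact: derivable_cst].
case: (split_ordP r) => [r' ->|r' ->]; last first.
  by under eq_fun do rewrite odds_row_total; exact: derivable_cst.
case: (split_ordP r') => [l ->|l ->].
  by under eq_fun do rewrite odds_row_nu; exact: derivable_cst.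
under eq_fun do rewrite odds_row_delta.
have /derivableP del := de l.
by apply: ex_derive; exact: is_derive1_comp.
Qed.

(** Brings the matrix that defines the c_ij under [logit_mx_unit]. *)
Lemma logit_mx_D_mx q : (forall k, 0 < q k 0) -> (1 < J)%N ->
  let E := \row_r ((L_mx lt *m q) r 0)^-1 in
  (forall r, 0 < E 0 r) /\
  CT_mx *m invmx (D_mx lt q) *m L_mx lt = logit_mx lt E.
Proof.
move=> q_gt0 J_gt1 E.
have Lq_gt0 r : 0 < (L_mx lt *m q) r 0.
  case: (split_ordP r) => [r' ->|r' ->]; last first.
    rewrite L_mx_total (bigD1 (Ordinal J_gt1)) //= ltr_wpDr //.
    by apply: sumr_ge0 => k _; exact: ltW.
  case: (split_ordP r') => [j ->|j ->]; first by rewrite L_mx_nu nu_gt0.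
  by rewrite L_mx_delta delta_gt0.
split=> [r|]; first by rewrite mxE invr_gt0.
rewrite /logit_mx; congr (_ *m _ *m _).
have DE : D_mx lt q *m diag_mx E = 1%:M.
  rewrite /D_mx mulmx_diag -diag_const_mx; congr diag_mx.
  apply/rowP => r; rewrite [LHS]mxE [X in X * _]mxE [X in _ * X]mxE [RHS]mxE.
  by rewrite mulfV // lt0r_neq0.
have [uD _] := mulmx1_unit DE.
by rewrite -[LHS]mulmx1 -DE mulKmx.
Qed.

(** The derivative of q solves the linear system with matrix C^T D^-1 L and right-hand side (z, 0),
    so it is a combination of the columns of the inverse. *)
Lemma logit_derive (q : R -> 'cV[R]_J) (e : R -> 'I_J.-1 -> R) x (z : 'I_J.-1 -> R) :
  (1 < J)%N ->
  (\forall s \near x, (forall k, 0 < q s k 0) /\ \sum_k q s k 0 = 1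
     /\ forall j, ln (nu j (q s) / delta j (q s)) = e s j) ->
  (forall j, is_derive x 1 (fun s => e s j) (z j)) ->
  forall k, is_derive x 1 (fun s => q s k 0)
    (\sum_j c_vec lt (q x) (widen_ord (leq_pred J) j) k 0 * z j).
Proof.
move=> J_gt1 q_logit de k.
(* Differentiability must be known before the equations are differentiated; it is inherited from
   [cat_prob]. *)
have q_cat k' : {near x, (fun s => cat_prob (e s) k' 0) =1 fun s => q s k' 0}.
  near=> s.
  have [q_gt0 qe] : (forall k, 0 < q s k 0) /\ \sum_k q s k 0 = 1
     /\ forall j, ln (nu j (q s) / delta j (q s)) = e s j by near: s.
  by have <- := (cat_probP (e s) J_gt1 q_gt0).1 qe.
have dq k' : derivable (fun s => q s k' 0) x 1.
  apply: near_eq_derivable (q_cat k') _.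
  by apply: derivable_cat_prob => j; exact: ex_derive.
have [q_gt0 _] := nbhs_singleton q_logit.
pose v := \col_k' 'D_1 (fun s => q s k' 0) x.
have dq' k' : is_derive x 1 (fun s => q s k' 0) (v k' 0).
  by rewrite mxE; exact/derivableP.
have dsum (A : {set 'I_J}) :
    is_derive x 1 (fun s => \sum_(k' in A) q s k' 0) (\sum_(k' in A) v k' 0).
  by apply: is_derive_bigsum => k' _; exact: dq'.
have v_total : \sum_k v k 0 = 0.
  rewrite (eq_bigl (fun k' => k' \in [set: 'I_J]%SET)) => [|k']; last by rewrite inE.
  have [_ <-] := dsum [set: 'I_J]%SET.
  rewrite -[RHS](derive_cst (1 : R) x 1); apply: near_eq_derive; near=> s.
  have [_ [q1 _]] : (forall k, 0 < q s k 0) /\ \sum_k q s k 0 = 1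
     /\ forall j, ln (nu j (q s) / delta j (q s)) = e s j by near: s.
  by rewrite -[RHS]q1; apply: eq_bigl => k'; rewrite inE.
(* Differentiating ln nu - ln delta yields the rows of C^T D^-1 L directly. *)
have v_logit j : (nu j (q x))^-1 * nu j v - (delta j (q x))^-1 * delta j v = z j.
  have [_ <-] := de j; symmetry.
  pose lnu s := ln (nu j (q s)) - ln (delta j (q s)).
  have -> : 'D_1 (fun s => e s j) x = 'D_1 lnu x.
    apply: near_eq_derive; near=> s.
    have [qs_gt0 [_ <-]] : (forall k, 0 < q s k 0) /\ \sum_k q s k 0 = 1
       /\ forall j, ln (nu j (q s) / delta j (q s)) = e s j by near: s.
    by rewrite ln_div ?posrE ?nu_gt0 ?delta_gt0.
  have dnu := dsum (nu_cat lt j); have ddel := dsum (delta_cat lt j).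
  have lnnu := is_derive1_ln (nu_gt0 j q_gt0).
  have lndel := is_derive1_ln (delta_gt0 j q_gt0).
  have d1 := is_derive1_comp lnnu dnu.
  have d2 := is_derive1_comp lndel ddel.
  by have [_ <-] : is_derive x 1 lnu _ := is_deriveB d1 d2.
have [E_gt0 ME] := logit_mx_D_mx q_gt0 J_gt1.
have Mv : logit_mx lt (\row_r ((L_mx lt *m q x) r 0)^-1) *m v =
    \col_a (if insub (a : nat) is Some j then z j else 0).
  apply/colP => a; rewrite logit_mxE [RHS]mxE ![(\row_r _) 0 _]mxE.
  rewrite L_mx_total v_total mulr0; case: insubP => // j _ _.
  by rewrite ![(\row_r _) 0 _]mxE L_mx_nu L_mx_delta v_logit.
suff <- : v k 0 = \sum_j c_vec lt (q x) (widen_ord (leq_pred J) j) k 0 * z j by [].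
rewrite -[v](mulKmx (logit_mx_unit lt E_gt0)) Mv -ME.
(* The last entry of the right-hand side is zero, so the last column of the inverse drops out. *)
rewrite mxE [LHS](bigID (fun a : 'I_J => (a < J.-1)%N)) /=.
rewrite [X in _ + X]big1 ?addr0; last by move=> a aJ; rewrite mxE insubN // mulr0.
rewrite (big_ord_narrow (leq_pred J)); apply: eq_bigr => j _.
rewrite !mxE /= insubT //= => jJ; congr (_ * z _); exact: val_inj.
Unshelve. all: by end_near.
Qed.

End CategoryProbabilities.

(** Reduces the partial derivatives in [score] to functions of one real variable, where the rules
    above apply. *)
Lemma derive_line (R : realType) (V W : normedModType R) (f : V -> W) (x v : V) :
  'D_v f x = 'D_1 (fun s : R => f (s *: v + x)) 0.
Proof.
rewrite /derive; set g1 := fun h => h^-1 *: _; set g2 := fun h => h^-1 *: _.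
suff -> : g1 = g2 by [].
by rewrite funeqE /g1 /g2 => s /=; rewrite addr0 scale0r add0r [_%:A]mulr1.
Qed.

(** The last row of the matrix is a nonzero multiple of the all-ones row, and every column of the
    inverse except the last is orthogonal to it. *)
Lemma c_vec_total (R : realType) (J : nat) (lt : logit_type) (q : 'cV[R]_J)
    (j : 'I_J.-1) : (1 < J)%N -> (forall k, 0 < q k 0) ->
  \sum_k c_vec lt q (widen_ord (leq_pred J) j) k 0 = 0.
Proof.
move=> J_gt1 q_gt0; have [E_gt0 ME] := logit_mx_D_mx lt q_gt0 J_gt1.
set E := \row__ _ in E_gt0 ME; have uM := logit_mx_unit lt E_gt0.
have J1 : (J.-1 < J)%N by rewrite ltn_predL ltnW.
have E0 := lt0r_neq0 (E_gt0 (rshift (J.-1 + J.-1) 0)).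
apply: (mulfI E0); rewrite mulr0.
transitivity ((logit_mx lt E *m c_vec lt q (widen_ord (leq_pred J) j)) (Ordinal J1) 0).
  by rewrite logit_mxE /= insubN ?ltnn.
rewrite /c_vec ME colE mulmxA mulmxV // mul1mx mxE eqxx andbT.
by rewrite -(inj_eq val_inj) /= gtn_eqF.
Qed.

(** * Jacobian of the category probabilities with respect to the parameter *)

Section ModelDerivative.
Variables (R : realType) (d m J : nat) (ps : 'I_J.-1 -> nat) (pc : nat).
Variables (lt : logit_type) (x : 'I_m -> 'cV[R]_d).
Variable h : forall j : 'I_J.-1, 'cV[R]_d -> 'cV[R]_(ps j).
Variable hc : 'cV[R]_d -> 'cV[R]_pc.
Hypothesis J_gt1 : (1 < J)%N.

Local Notation p := (\sum_j ps j + pc)%N.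

Definition logit_pred (t : 'cV[R]_p) (i : 'I_m) (j : 'I_J.-1) : R :=
  ((h j (x i))^T *m beta t j) 0 0 + ((hc (x i))^T *m zeta t) 0 0.

Lemma logit_pred_line (s : R) (u t : 'cV[R]_p) i j :
  logit_pred (s *: u + t) i j = s * logit_pred u i j + logit_pred t i j.
Proof.
rewrite /logit_pred /beta /zeta !linearP /=.
have -> : submxcol (s *: usubmx u + usubmx t) j
    = s *: submxcol (usubmx u) j + submxcol (usubmx t) j.
  by apply/colP => k; rewrite !mxE.
by rewrite linearP /= !mxE; ring.
Qed.

(** A block of G acts on a parameter only through its linear predictors; this is the form that
    [logit_derive] produces. *)
Lemma G_block_mulE (q : 'I_m -> 'cV[R]_J) i (t : 'cV[R]_p) k :
  (G_block lt x h hc q i *m t) k 0 =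
    \sum_j c_vec lt (q i) (widen_ord (leq_pred J) j) k 0 * logit_pred t i j.
Proof.
rewrite /G_block -[t in LHS]vsubmxK mul_row_col -[usubmx t]submxcolK.
rewrite mul_mxrow_mxcol !mulmx_suml [LHS]mxE !summxE -big_split /=.
apply: eq_bigr => j _; rewrite /logit_pred mulrDr -!mulmxA.
by congr (_ + _); rewrite [X in _ *m X]mx11_scalar mul_mx_scalar mxE mulrC.
Qed.

Lemma G_blockE (q : 'I_m -> 'cV[R]_J) i k a :
  G_block lt x h hc q i k a =
    \sum_j c_vec lt (q i) (widen_ord (leq_pred J) j) k 0 * logit_pred (delta_mx a 0) i j.
Proof. by rewrite -G_block_mulE -colE [RHS]mxE. Qed.

Lemma G_block_total (q : 'I_m -> 'cV[R]_J) i a : (forall k, 0 < q i k 0) ->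
  \sum_k G_block lt x h hc q i k a = 0.
Proof.
move=> q_gt0; rewrite (eq_bigr _ (fun k _ => G_blockE q i k a)).
rewrite exchange_big big1 //= => j _.
by rewrite -mulr_suml c_vec_total // mul0r.
Qed.

Variables (pi : 'cV[R]_p -> 'I_m -> 'cV[R]_J) (theta : 'cV[R]_p).
Hypothesis pi_model : forall t, param_space lt x h hc t ->
                                logit_model lt x h hc t (pi t).
Hypothesis theta_in : param_space lt x h hc theta.

Lemma is_derive_logit_pred (u : 'cV[R]_p) i j :
  is_derive (0 : R) 1 (fun s => logit_pred (s *: u + theta) i j) (logit_pred u i j).
Proof.
under eq_fun do rewrite logit_pred_line.
have d1 : is_derive (0 : R) 1 (fun s : R => s * logit_pred u i j) (logit_pred u i j).
  have := is_deriveM (is_derive_id (0 : R) 1) (is_derive_cst (logit_pred u i j) (0 : R) 1).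
  move/is_derive_eq; apply.
  by rewrite /= scaler0 add0r [_ *: _]mulr1.
have := is_deriveD d1 (is_derive_cst (logit_pred theta i j) (0 : R) 1).
by move/is_derive_eq; apply; rewrite addr0.
Qed.

(* The parameter space is open along every line through theta: the solution of
   the logit equations depends continuously on the parameter, so it remains
   positive. *)
Lemma near_param_space (u : 'cV[R]_p) :
  \forall s \near (0 : R), param_space lt x h hc (s *: u + theta).
Proof.
have [q_gt0 q1 qe] := pi_model theta_in.
pose q (s : R) i := cat_prob lt (logit_pred (s *: u + theta) i).
have q0 i : q 0 i = pi theta i.
  rewrite /q scale0r add0r; symmetry; apply/(cat_probP lt _ J_gt1 (q_gt0 i)).
  by split=> [|j]; [exact: q1|exact: qe].
have qpos (ik : 'I_m * 'I_J) : \forall s \near (0 : R), 0 < q s ik.1 ik.2 0.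
  case: ik => i k /=.
  have dq : derivable (fun s => q s i k 0) 0 1.
    apply: (derivable_cat_prob (e := fun s => logit_pred (s *: u + theta) i)) => j.
    by have [] := is_derive_logit_pred u i j.
  have cq : {for 0, continuous (fun s => q s i k 0)}.
    exact/differentiable_continuous/derivable1_diffP.
  have : 0 < q 0 i k 0 by rewrite q0.
  by move=> /lt_nbhsr/cq.
(* There are finitely many pairs of setting and category, so one neighbourhood serves them all. *)
have {}qpos := @filter_forall _ _ _ (nbhs (0 : R)) _ qpos.
near=> s; exists (q s).
have qs_gt0 i k : 0 < q s i k 0.
  have qs : forall ik : 'I_m * 'I_J, 0 < q s ik.1 ik.2 0.
    by near: s; exact: qpos.
  exact: (qs (i, k)).
have qsP i := (cat_probP lt (logit_pred (s *: u + theta) i) J_gt1 (qs_gt0 i)).2 erefl.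
by split=> // i; have [] := qsP i.
Unshelve. all: by end_near. Qed.

Lemma is_derive_pi a i k :
  is_derive (0 : R) 1 (fun s => pi (s *: delta_mx a 0 + theta) i k 0)
    (G_block lt x h hc (pi theta) i k a).
Proof.
rewrite G_blockE.
have -> : pi theta i = pi (0 *: delta_mx a 0 + theta) i by rewrite scale0r add0r.
apply: (logit_derive (q := fun s => pi (s *: delta_mx a 0 + theta) i)
  (e := fun s => logit_pred (s *: delta_mx a 0 + theta) i)) => // [|j]; last first.
  exact: is_derive_logit_pred.
near=> s.
have s_in : param_space lt x h hc (s *: delta_mx a 0 + theta).
  by near: s; exact: near_param_space.
have [q_gt0 q1 qe] := pi_model s_in.
by split; [exact: q_gt0|split=> [|j]; [exact: q1|exact: qe]].
Unshelve. all: by end_near. Qed.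

End ModelDerivative.

(** * Score and Fisher information *)

Section ProductExpectation.
Variables (R : realFieldType) (I O : finType) (w : I -> O -> R).
Hypothesis w_total : forall i, \sum_y w i y = 1.

Lemma sum_prod_pair k l (f g : O -> R) :
  \sum_(o : {ffun I -> O}) (\prod_i w i (o i)) * (f (o k) * g (o l)) =
    if k == l then \sum_y w k y * (f y * g y)
    else (\sum_y w k y * f y) * (\sum_y w l y * g y).
Proof.
(* Written as a product over all i, the summand turns the sum over outcomes into a product of sums,
   equal to 1 away from k and l. *)
pose W i y := w i y * ((if i == k then f y else 1) * (if i == l then g y else 1)).
transitivity (\sum_(o : {ffun I -> O}) \prod_i W i (o i)).
  apply: eq_bigr => o _; rewrite big_split big_split /= -!big_mkcond.
  by rewrite !big_pred1_eq.
rewrite -bigA_distr_bigA.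
have W1 i : i != k -> i != l -> \sum_y W i y = 1.
  move=> /negPf ik /negPf il; rewrite -[RHS](w_total i).
  by apply: eq_bigr => y _; rewrite /W ik il !mulr1.
rewrite (bigD1 k) //=; case: eqP => [kl|/eqP kl].
  rewrite [X in _ * X]big1 => [|i ik]; last by apply: W1; rewrite -?kl.
  by rewrite mulr1; apply: eq_bigr => y _; rewrite /W -kl eqxx.
rewrite (bigD1 l) /=; last by rewrite eq_sym.
rewrite [X in _ * (_ * X)]big1 ?mulr1 => [|i /andP[ik il]]; last exact: W1.
congr (_ * _); apply: eq_bigr => y _; rewrite /W eqxx ?(negPf kl) ?mulr1 //.
by rewrite eq_sym (negPf kl) mul1r.
Qed.

Lemma mean_prod (u : I -> O -> R) :
  (forall i, \sum_y w i y * u i y = 0) ->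
  \sum_(o : {ffun I -> O}) (\prod_i w i (o i)) * \sum_i u i (o i) = 0.
Proof.
move=> u0; under eq_bigr do rewrite mulr_sumr.
rewrite exchange_big big1 //= => k _.
rewrite (eq_bigr (fun o : {ffun I -> O} => (\prod_i w i (o i)) * (u k (o k) * 1)));
  last by move=> o _; rewrite mulr1.
rewrite (sum_prod_pair k k (u k) (fun=> 1)) eqxx -[RHS](u0 k).
by apply: eq_bigr => y _; rewrite mulr1.
Qed.

Lemma second_moment_prod (u v : I -> O -> R) :
  (forall i, \sum_y w i y * u i y = 0) ->
  \sum_(o : {ffun I -> O})
     (\prod_i w i (o i)) * ((\sum_i u i (o i)) * (\sum_i v i (o i))) =
    \sum_i \sum_y w i y * (u i y * v i y).
Proof.
move=> u0.
transitivity (\sum_k \sum_l \sum_(o : {ffun I -> O})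
    (\prod_i w i (o i)) * (u k (o k) * v l (o l))).
  under [RHS]eq_bigr do rewrite exchange_big.
  rewrite [RHS]exchange_big /=; apply: eq_bigr => o _.
  rewrite big_distrlr /= mulr_sumr; apply: eq_bigr => k _.
  by rewrite mulr_sumr.
apply: eq_bigr => k _; rewrite (bigD1 k) //= sum_prod_pair eqxx.
rewrite [X in _ + X]big1 ?addr0 // => l lk.
by rewrite sum_prod_pair eq_sym (negPf lk) u0 mul0r.
Qed.

End ProductExpectation.

Lemma expectation_simple (R : realType) d (T : measurableType d)
    (P : probability T R) (I : finType) (Q : pred I) (E : I -> set T) (f : I -> R) :
  (forall i, measurable (E i)) ->
  expectation P (fun t => \sum_(i | Q i) f i * \1_(E i) t) =
    (\sum_(i | Q i) f i * fine (P (E i)))%:E.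
Proof.
move=> mE; rewrite unlock.
under eq_integral do rewrite -sumEFin.
have int1 i : P.-integrable setT (fun t => (\1_(E i) t)%:E).
  exact: integrable_indic.
rewrite (@integral_sum _ _ _ _ _ measurableT _ (fun i t => (f i * \1_(E i) t)%:E)).
  rewrite -sumEFin; apply: eq_bigr => i _.
  under eq_integral do rewrite EFinM.
  rewrite integralZl // integral_indic // setIT EFinM fineK //.
  exact: fin_num_measure.
move=> i; under eq_fun do rewrite EFinM.
exact: integrableZl.
Qed.

Lemma measurable_tuple_singleton (J : nat) (y : J.-tuple nat) :
  measurable [set y].
Proof.
rewrite (_ : [set y] = \bigcap_(j in [set: 'I_J])
    ((fun t : J.-tuple nat => tnth t j) @^-1` [set tnth y j])).
  apply: fin_bigcap_measurable => [|j _]; first exact: finite_finset.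
  by rewrite -[X in measurable X]setTI; apply: measurable_tnth.
rewrite predeqE => t; split=> [-> //|yt].
by apply: eq_from_tnth => j; exact: yt.
Qed.

Lemma ln_prod (R : realType) (I : Type) (r : seq I) (Q : pred I) (f : I -> R) :
  (forall i, Q i -> 0 < f i) ->
  ln (\prod_(i <- r | Q i) f i) = \sum_(i <- r | Q i) ln (f i).
Proof.
move=> f_gt0; elim: r => [|i r IHr]; first by rewrite !big_nil ln1.
rewrite !big_cons; case: ifPn => // Qi.
by rewrite lnM ?IHr // posrE ?f_gt0 // prodr_gt0.
Qed.

Lemma ln_multinomial_pmf (R : realType) (J N : nat) (q : 'cV[R]_J) (y : J.-tuple nat) :
  (forall j, 0 < q j 0) -> (\sum_(j < J) tnth y j = N)%N ->
  0 < multinomial_pmf N q y /\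
  ln (multinomial_pmf N q y) =
    ln (N`!%:R / (\prod_(j < J) (tnth y j)`!)%N%:R)
      + \sum_j (tnth y j)%:R * ln (q j 0).
Proof.
move=> q_gt0 yN; rewrite /multinomial_pmf yN eqxx.
have C_gt0 : 0 < N`!%:R / (\prod_(j < J) (tnth y j)`!)%N%:R :> R.
  rewrite divr_gt0 // ltr0n ?fact_gt0 //.
  by apply: prodn_gt0 => j; rewrite fact_gt0.
have q_gt0' j : 0 < q j 0 ^+ tnth y j by rewrite exprn_gt0.
split; first by rewrite mulr_gt0 // prodr_gt0.
rewrite lnM ?posrE ?prodr_gt0 // ln_prod //; congr (_ + _).
by apply: eq_bigr => j _; rewrite lnXn // mulr_natl.
Qed.

(** * The score and its reduction to finitely many outcomes *)

Section Score.
Variables (R : realType) (d m J : nat) (ps : 'I_J.-1 -> nat) (pc : nat).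
Variables (lt : logit_type) (x : 'I_m -> 'cV[R]_d).
Variable h : forall j : 'I_J.-1, 'cV[R]_d -> 'cV[R]_(ps j).
Variable hc : 'cV[R]_d -> 'cV[R]_pc.
Local Notation p := (\sum_j ps j + pc)%N.
Variables (pi : 'cV[R]_p -> 'I_m -> 'cV[R]_J) (theta : 'cV[R]_p).
Variable ns : 'I_m -> nat.

Lemma score_eq (y y' : 'I_m -> J.-tuple nat) a :
  (forall i, (0 < ns i)%N -> y i = y' i) ->
  score ns pi y theta a = score ns pi y' theta a.
Proof.
move=> yy'; have lE : loglik ns pi y = loglik ns pi y'.
  by apply/funext => t; congr ln; apply: eq_bigr => i /yy' ->.
by rewrite /score lE.
Qed.

(** Such an outcome has likelihood 0 at every parameter, so the log-likelihood is the constant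
    [ln 0], whatever that value is. *)
Lemma score_invalid (y : 'I_m -> J.-tuple nat) a i : (0 < ns i)%N ->
  (\sum_(j < J) tnth (y i) j)%N != ns i -> score ns pi y theta a = 0.
Proof.
move=> ni yi; have lE : loglik ns pi y = cst (ln 0).
  apply/funext => t; rewrite /loglik (bigD1 i) //=.
  by rewrite /multinomial_pmf (negPf yi) mul0r.
by rewrite /score lE derive_cst.
Qed.

Hypothesis J_gt1 : (1 < J)%N.
Hypothesis pi_model : forall t, param_space lt x h hc t ->
                                logit_model lt x h hc t (pi t).
Hypothesis theta_in : param_space lt x h hc theta.

Lemma score_valid (y : 'I_m -> J.-tuple nat) a :
  (forall i, (0 < ns i)%N -> \sum_(j < J) tnth (y i) j = ns i)%N ->
  score ns pi y theta a =
    \sum_(i < m | (0 < ns i)%N) \sum_j (tnth (y i) j)%:R *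
       (G_block lt x h hc (pi theta) i j a / pi theta i j 0).
Proof.
move=> yN; rewrite /score derive_line.
pose l i s := ln ((ns i)`!%:R / (\prod_(j < J) (tnth (y i) j)`!)%N%:R)
  + \sum_j (tnth (y i) j)%:R * ln (pi (s *: delta_mx a 0 + theta) i j 0).
(* The two functions are compared only near 0, where the line stays in the parameter space and the
   logarithm of the product splits. *)
transitivity ('D_1 (fun s => \sum_(i < m | (0 < ns i)%N) l i s) 0).
  apply: near_eq_derive; near=> s.
  have s_in : param_space lt x h hc (s *: delta_mx a 0 + theta).
    by near: s; exact: (near_param_space J_gt1 pi_model theta_in).
  have [q_gt0 _ _] := pi_model s_in.
  have pmfP i ni := ln_multinomial_pmf (q_gt0 i) (yN i ni).
  rewrite /loglik ln_prod => [|i ni]; last by have [] := pmfP i ni.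
  by apply: eq_bigr => i ni; have [_ ->] := pmfP i ni.
have dl i : is_derive (0 : R) 1 (l i) (\sum_j (tnth (y i) j)%:R *
     (G_block lt x h hc (pi theta) i j a / pi theta i j 0)).
  rewrite -[X in is_derive _ _ _ X]add0r.
  apply: is_deriveD; apply: is_derive_bigsum => j _.
  have pi_gt0 : 0 < pi (0 *: delta_mx a 0 + theta) i j 0.
    by rewrite scale0r add0r; have [q_gt0 _ _] := pi_model theta_in; exact: q_gt0.
  have dpi := is_derive_pi J_gt1 pi_model theta_in a i j.
  have dlnpi := is_derive1_comp (is_derive1_ln pi_gt0) dpi.
  have := is_deriveM (is_derive_cst ((tnth (y i) j)%:R : R) (0 : R) 1) dlnpi.
  move/is_derive_eq; apply.
  by rewrite /= scaler0 addr0 scale0r add0r /cst [_ *: _]/(_ * _) [X in _ * X]mulrC.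
by have [_ ->] := @is_derive_bigsum R 'I_m (index_enum _)
  (fun i => (0 < ns i)%N) l _ 0 (fun i _ => dl i).
Unshelve. all: by end_near. Qed.

Section Law.
Variables (dT : measure_display) (T : measurableType dT) (P : probability T R).
Variable Y : 'I_m -> {RV P >-> (J.-tuple nat)}.
Variable q : 'I_m -> 'cV[R]_J.
Hypothesis Y_law : forall i, (0 < ns i)%N -> multinomial_law (ns i) (q i) (Y i).
Hypothesis Y_indep : mutually_independent [set i : 'I_m | (0 < ns i)%N]%SET Y.

Local Notation B := (\sum_(i < m) ns i)%N.
Local Notation outcomes := {ffun 'I_m -> {ffun 'I_J -> 'I_B.+1}}.
Local Notation counts o := (fun i => counts_of (o i)).
Local Notation total y := (\sum_(j < J) tnth y j)%N.

Lemma prod_pmf_valid (o : outcomes) :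
  \prod_i multinomial_pmf (ns i) (q i) (counts_of (o i)) != 0 ->
  forall i, total (counts_of (o i)) = ns i.
Proof.
move=> + i; apply: contra_neqP => oi.
by rewrite (bigD1 i) //= /multinomial_pmf (introF eqP oi) mul0r.
Qed.

Let E (o : outcomes) : set T :=
  \bigcap_(i in [set` [set i : 'I_m | (0 < ns i)%N]%SET])
    (Y i @^-1` [set counts_of (o i)]).

Let mE o : measurable (E o).
Proof.
apply: fin_bigcap_measurable => [|i _]; first exact: finite_finset.
by apply: measurable_funPTI; exact: measurable_tuple_singleton.
Qed.

Lemma joint_law (o : outcomes) : (forall i, total (counts_of (o i)) = ns i) ->
  fine (P (E o)) = \prod_i multinomial_pmf (ns i) (q i) (counts_of (o i)).
Proof.
move=> oN; rewrite /E Y_indep //; last first.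
  by move=> i _; exact: measurable_tuple_singleton.
rewrite (eq_bigr (fun i => (multinomial_pmf (ns i) (q i) (counts_of (o i)))%:E)).
  rewrite prodEFin /= [RHS](bigID (mem [set i : 'I_m | (0 < ns i)%N]%SET)) /=.
  (* At a setting with n_i = 0 validity forces the zero count, whose pmf is 1. *)
  rewrite [X in _ * X]big1 ?mulr1 // => i.
  rewrite inE -eqn0Ngt => /eqP ni; rewrite ni; apply: multinomial_pmf0.
  by rewrite oN.
by move=> i; rewrite inE => ni; rewrite Y_law.
Qed.

(** The hypotheses on g, which [score] and products of scores satisfy, make the integrand a finite
    combination of indicators of the disjoint events [E o] for valid o. *)
Lemma expectation_outcomes (g : ('I_m -> J.-tuple nat) -> R) :
  (forall y y', (forall i, (0 < ns i)%N -> y i = y' i) -> g y = g y') ->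
  (forall y i, (0 < ns i)%N -> total (y i) != ns i -> g y = 0) ->
  expectation P (fun w => g (fun i => Y i w)) =
    (\sum_(o : outcomes)
       (\prod_i multinomial_pmf (ns i) (q i) (counts_of (o i))) * g (counts o))%:E.
Proof.
move=> g_eq g_invalid.
pose valid (o : outcomes) := [forall i, total (counts_of (o i)) == ns i].
have EP (o : outcomes) w : w \in E o -> forall i, (0 < ns i)%N -> Y i w = counts_of (o i).
  by rewrite inE => Eo i ni; apply: Eo; rewrite /= inE.
have -> : (fun w => g (fun i => Y i w)) =
    (fun w => \sum_(o | valid o) g (counts o) * \1_(E o) w).
  apply/funext => w; rewrite [RHS](eq_bigr (fun o => g (fun i => Y i w) * \1_(E o) w)).
    rewrite -mulr_sumr.
    have [|/forallPn[i]] := boolP [forall i, (0 < ns i)%N ==> (total (Y i w) == ns i)].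
      move/forallP => /= Yw.
      have YN i : (0 < ns i)%N -> total (Y i w) = ns i.
        by move=> ni; exact/eqP/(implyP (Yw i)).
      (* The code of the observed counts, with zeros at settings without trials: the only valid
         choice there, which makes [o0] unique. *)
      pose o0 : outcomes := [ffun i => [ffun j =>
        if (0 < ns i)%N then inord (tnth (Y i w) j) else ord0]].
      have o0Y i : (0 < ns i)%N -> counts_of (o0 i) = Y i w.
        move=> ni; apply: eq_from_tnth => j; rewrite tnth_mktuple !ffunE ni inordK //.
        rewrite ltnS (@leq_trans (ns i)) //; last by rewrite (bigD1 i) //= leq_addr.
        by rewrite -(YN i ni) (bigD1 j) //= leq_addr.
      have o0_valid : valid o0.
        apply/forallP => i; case: (posnP (ns i)) => [ni|ni]; last by rewrite o0Y ?YN.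
        by rewrite ni big1 // => j _; rewrite tnth_mktuple !ffunE ni.
      rewrite (bigD1 o0) //= indicE mem_set ?big1 ?addr0 ?mulr1 //.
        move=> o /andP[valid_o oo0]; rewrite indicE memNset // => Eo.
        case/negP: (oo0); apply/eqP/ffunP => i; apply/ffunP => j; apply: val_inj.
        case: (posnP (ns i)) => [ni|ni].
          rewrite !ffunE ni /=; have := forallP valid_o i.
          by rewrite ni sum_nat_eq0 => /forallP/(_ j)/eqP; rewrite tnth_mktuple.
        have := EP o w (mem_set Eo) i ni; rewrite -o0Y // => /(congr1 (fun t => tnth t j)).
        by rewrite !tnth_mktuple.
      by move=> i /=; rewrite inE => ni; rewrite /= o0Y.
    rewrite negb_imply => /andP[ni Yi].
    by rewrite (g_invalid _ i ni Yi) mul0r.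
  move=> o _; rewrite indicE; case: (boolP (w \in E o)) => [Eo|_]; last by rewrite !mulr0.
  by congr (_ * _); apply: g_eq => i ni; rewrite (EP o w Eo i ni).
rewrite expectation_simple //; congr (_%:E).
(* Outcomes that are not valid have product weight zero. *)
rewrite [RHS](bigID valid) /= [X in _ = _ + X]big1 ?addr0 => [|o].
  apply: eq_bigr => o /forallP oN; rewrite mulrC joint_law // => i.
  exact/eqP/oN.
apply: contraNeq; rewrite mulf_eq0 => /norP[/prod_pmf_valid oN _].
by apply/forallP => i; rewrite oN.
Qed.

End Law.
End Score.

(** * Entries of the Fisher information matrix *)

Lemma covariance_centred (R : realType) d (T : measurableType d)
    (P : probability T R) (U V : T -> R) :
  expectation P U = 0%:E -> expectation P V = 0%:E ->
  covariance P U V = expectation P (fun t => U t * V t).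
Proof.
move=> U0 V0; rewrite covariance.unlock U0 V0; congr (expectation P _).
by apply/funext => t; rewrite -[U t in RHS]subr0 -[V t in RHS]subr0.
Qed.

Section FisherEntries.
Variables (R : realType) (d m J : nat) (ps : 'I_J.-1 -> nat) (pc : nat).
Variables (lt : logit_type) (x : 'I_m -> 'cV[R]_d).
Variable h : forall j : 'I_J.-1, 'cV[R]_d -> 'cV[R]_(ps j).
Variable hc : 'cV[R]_d -> 'cV[R]_pc.
Local Notation p := (\sum_j ps j + pc)%N.
Variables (pi : 'cV[R]_p -> 'I_m -> 'cV[R]_J) (theta : 'cV[R]_p).
Variable ns : 'I_m -> nat.
Hypothesis J_gt1 : (1 < J)%N.
Hypothesis pi_model : forall t, param_space lt x h hc t ->
                                logit_model lt x h hc t (pi t).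
Hypothesis theta_in : param_space lt x h hc theta.
Variables (dT : measure_display) (T : measurableType dT) (P : probability T R).
Variable Y : 'I_m -> {RV P >-> (J.-tuple nat)}.
Hypothesis Y_law :
  forall i, (0 < ns i)%N -> multinomial_law (ns i) (pi theta i) (Y i).
Hypothesis Y_indep : mutually_independent [set i : 'I_m | (0 < ns i)%N]%SET Y.

Local Notation B := (\sum_(i < m) ns i)%N.
Local Notation G i j a := (G_block lt x h hc (pi theta) i j a).

Let q_gt0 i j : 0 < pi theta i j 0.
Proof. by have [] := pi_model theta_in. Qed.

Let q_total i : \sum_j pi theta i j 0 = 1.
Proof. by have [] := pi_model theta_in. Qed.

Let ns_le i : (ns i <= B)%N.
Proof. by rewrite (bigD1 i) //= leq_addr. Qed.

Let w i (y : {ffun 'I_J -> 'I_B.+1}) : R :=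
  multinomial_pmf (ns i) (pi theta i) (counts_of y).

Let u a i (y : {ffun 'I_J -> 'I_B.+1}) : R :=
  \sum_j (tnth (counts_of y) j)%:R * (G i j a / pi theta i j 0).

Let w_total i : \sum_y w i y = 1.
Proof. exact: sum_multinomial_pmf. Qed.

Let G_centred a i : \sum_j pi theta i j 0 * (G i j a / pi theta i j 0) = 0.
Proof.
rewrite -[RHS](G_block_total lt x h hc J_gt1 a (q_gt0 i)).
by apply: eq_bigr => j _; rewrite mulrC divfK // lt0r_neq0.
Qed.

Let u_mean a i : \sum_y w i y * u a i y = 0.
Proof.
transitivity (\sum_j (G i j a / pi theta i j 0) *
    \sum_y w i y * (tnth (counts_of y) j)%:R).
  under [RHS]eq_bigr do rewrite mulr_sumr.
  rewrite [RHS]exchange_big /=; apply: eq_bigr => y _.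
  by rewrite /u mulr_sumr; apply: eq_bigr => j _; ring.
transitivity ((ns i)%:R * \sum_j pi theta i j 0 * (G i j a / pi theta i j 0)).
  rewrite [RHS]mulr_sumr; apply: eq_bigr => j _.
  by rewrite multinomial_mean // mulrC mulrA.
by rewrite G_centred mulr0.
Qed.

Let score_outcome (o : {ffun 'I_m -> {ffun 'I_J -> 'I_B.+1}}) a :
  \prod_i w i (o i) != 0 ->
  score ns pi (fun i => counts_of (o i)) theta a = \sum_i u a i (o i).
Proof.
move=> /prod_pmf_valid oN.
rewrite (score_valid J_gt1 pi_model theta_in) => [|i _]; last exact: oN.
rewrite [RHS](bigID (fun i => 0 < ns i)%N) /= [X in _ = _ + X]big1 ?addr0 //.
move=> i; rewrite -eqn0Ngt => /eqP ni; rewrite /u big1 // => j _.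
have /eqP := oN i; rewrite ni sum_nat_eq0 => /forallP/(_ j)/eqP ->.
by rewrite mul0r.
Qed.

Let score_mean a :
  expectation P (fun t => score ns pi (fun i => Y i t) theta a) = 0%:E.
Proof.
rewrite (expectation_outcomes Y_law Y_indep (g := fun y => score ns pi y theta a));
  [|by move=> y y'; exact: score_eq|by move=> y i; exact: score_invalid].
congr (_%:E); rewrite -[RHS](mean_prod w_total (u_mean a)).
apply: eq_bigr => o _; rewrite -/(w _ _).
have [->|w0] := eqVneq (\prod_i w i (o i)) 0; first by rewrite !mul0r.
by rewrite score_outcome.
Qed.

Lemma Fisher_informationE a b :
  Fisher_information ns pi Y theta a b =
    \sum_i (ns i)%:R * \sum_j G i j a * (pi theta i j 0)^-1 * G i j b.
Proof.
rewrite [LHS]mxE (covariance_centred (score_mean a) (score_mean b)).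
rewrite (expectation_outcomes Y_law Y_indep
  (g := fun y => score ns pi y theta a * score ns pi y theta b)) /=; first last.
- by move=> y i ni yi; rewrite (score_invalid _ _ _ ni yi) mul0r.
- by move=> y y' yy'; rewrite !(score_eq pi theta _ yy').
transitivity (\sum_(o : {ffun 'I_m -> {ffun 'I_J -> 'I_B.+1}})
    (\prod_i w i (o i)) * ((\sum_i u a i (o i)) * (\sum_i u b i (o i)))).
  apply: eq_bigr => o _; rewrite -/(w _ _).
  have [->|w0] := eqVneq (\prod_i w i (o i)) 0; first by rewrite !mul0r.
  by rewrite !score_outcome.
(* Cross terms between different settings vanish because the summands of the score are centred. *)
rewrite (second_moment_prod w_total _ (u_mean a)); apply: eq_bigr => i _.
transitivity ((ns i)%:R * \sum_j pi theta i j 0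
    * (G i j a / pi theta i j 0) * (G i j b / pi theta i j 0)).
  rewrite -(multinomial_centred_moment (q_total i) (fun j => G i j b / pi theta i j 0)
    (ns_le i) (G_centred a i)).
  by apply: eq_bigr => y _; exact: mulrA.
congr (_ * _); apply: eq_bigr => j _.
by have q0 := lt0r_neq0 (q_gt0 i j); field.
Qed.

End FisherEntries.

(** * The determinant formula *)

Lemma sum_rows (V : nmodType) (m J : nat) (f : 'I_m -> 'I_J -> V) :
  \sum_(r < m * J) f (row_block r) (row_cat r) = \sum_(i < m) \sum_(j < J) f i j.
Proof.
rewrite pair_big /=.
pose rc (r : 'I_(m * J)) := (row_block r, row_cat r).
rewrite (reindex rc) //; apply: onW_bij; apply: inj_card_bij => [r s [rs rs']|].
  by apply: val_inj; rewrite /= (divn_eq r J) (divn_eq s J) rs rs'.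
by rewrite card_prod !card_ord.
Qed.

Theorem theorem4p2 (R : realType) (lt : logit_type) (d m J : nat)
  (d_ge1 : (1 <= d)%N) (m_ge2 : (2 <= m)%N) (J_ge2 : (2 <= J)%N)
  (x : 'I_m -> 'cV[R]_d) (x_inj : injective x)
  (ns : 'I_m -> nat) (n_gt0 : (0 < \sum_(i < m) ns i)%N)
  (ps : 'I_J.-1 -> nat) (pc : nat)
  (h : forall j : 'I_J.-1, 'cV[R]_d -> 'cV[R]_(ps j))
  (hc : 'cV[R]_d -> 'cV[R]_pc)
  (pi : 'cV[R]_(\sum_j ps j + pc) -> 'I_m -> 'cV[R]_J)
  (pi_model : forall t, param_space lt x h hc t ->
                        logit_model lt x h hc t (pi t))
  (theta : 'cV[R]_(\sum_j ps j + pc))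
  (theta_in : param_space lt x h hc theta)
  (dT : measure_display) (T : measurableType dT) (P : probability T R)
  (Y : 'I_m -> {RV P >-> (J.-tuple nat)})
  (Y_law : forall i, (0 < ns i)%N -> multinomial_law (ns i) (pi theta i) (Y i))
  (Y_indep : mutually_independent [set i : 'I_m | (0 < ns i)%N]%SET Y) :
  let p := (\sum_j ps j + pc)%N in
  let n := (\sum_(i < m) ns i)%N in
  let F := Fisher_information ns pi Y theta in
  let G := G_mx lt x h hc (pi theta) in
  let W := W_mx ns (pi theta) in
  let c := coef lt x h hc (pi theta) in
  [/\ \det F = n%:R ^+ p * \det (G^T *m W *m G),
      n%:R ^+ p * \det (G^T *m W *m G)
      = n%:R ^+ p
        * \sum_(alpha : {ffun 'I_m -> 'I_p.+1}
                 | (\sum_(i < m) (alpha i : nat) == p)%N)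
            c (fun i => nat_of_ord (alpha i))
            * \prod_(i < m) weight ns i ^+ alpha i
    & forall alpha : 'I_m -> nat, 0 <= c alpha].
Proof.
move=> p n F G W c.
have [q_gt0 _ _] := pi_model _ theta_in.
split.
(* The factor n^p is the determinant's response to scaling by n, so F = n G^T W G can be checked
   entry by entry. *)
- rewrite -detZ; congr (\det _); apply/matrixP => a b.
  rewrite /F (Fisher_informationE J_ge2 pi_model theta_in Y_law Y_indep).
  rewrite [RHS]mxE [X in _ * X]mxE mulr_sumr.
  pose f i j := G_block lt x h hc (pi theta) i j a
    * ((ns i)%:R * (pi theta i j 0)^-1) * G_block lt x h hc (pi theta) i j b.
  transitivity (\sum_(r < m * J) f (row_block r) (row_cat r)).
    rewrite sum_rows; apply: eq_bigr => i _; rewrite mulr_sumr.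
    by apply: eq_bigr => j _; rewrite /f; ring.
  apply: eq_bigr => r _; rewrite /f /W /W_mx mul_mx_diag /weight !mxE.
  have n0 : n%:R != 0 :> R by rewrite pnatr_eq0 -lt0n.
  rewrite -/n; have q0 := lt0r_neq0 (q_gt0 (row_block r) (row_cat r)).
  by field; rewrite n0 q0.
- congr (_ * _); rewrite Cauchy_Binet sum_sorted_Lambda.
  apply: eq_bigr => alpha _; rewrite /c /coef mulr_suml.
  apply: eq_bigr => s s_alpha; rewrite -mulrA.
  rewrite (prod_Lambda (weight ns) (fun k j => (pi theta k j 0)^-1) s_alpha).
  (* As W is diagonal, the minor of G^T W is the same minor of G times the selected weights; this is
     where the square comes from. *)
  have -> : colsub (tnth s) (G^T *m W) = (rowsub (tnth s) G)^T *m
      diag_mx (\row_l (weight ns (row_block (tnth s l))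
                 * (pi theta (row_block (tnth s l)) (row_cat (tnth s l)) 0)^-1)).
    by apply/matrixP => a l; rewrite /W /W_mx !mul_mx_diag !mxE.
  rewrite det_mulmx det_tr det_diag expr2 mulrAC; congr (_ * _).
  by apply: eq_bigr => l _; rewrite mxE.
move=> alpha; apply: sumr_ge0 => s _; rewrite mulr_ge0 ?sqr_ge0 //.
by apply: prodr_ge0 => k _; apply: prodr_ge0 => l _; rewrite invr_ge0 ltW.
Qed.
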